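(* Let $\nu\ge0$, $\alpha>0$ be real and let $\lambda\in\mathbb{C}$, $\lambda\ne0$. Write $A=B_{\nu,-}^{-\alpha}$. Let $f\in C^{[2\alpha]+1}(0,+\infty)$ be such that $\sum_{k=1}^\infty|\lambda|^{-k}\,(A^k|f|)(x)<\infty$ for every $x>0$. Then for every $x>0$ the resolvent $R_\lambda f=(A-\lambda I)^{-1}f$, given by the Neumann series $R_\lambda f=-\frac1\lambda f-\frac1\lambda\sum_{k=1}^\infty\lambda^{-k}A^kf$, satisfies $$(R_\lambda f)(x)=-\frac{1}{\lambda}f(x)-\frac{1}{\lambda^2}\int_x^{\infty}f(y)\left(\frac{y^2-x^2}{2y}\right)^{2\alpha-1}\left[\int_0^1 t^{\alpha-1}(1-t)^{\alpha-1}\left(1-\left(1-\frac{x^2}{y^2}\right)t\right)^{-\alpha-\frac{\nu-1}{2}}E_{(\alpha,\alpha),(\alpha,\alpha)}\left(\frac1\lambda\left(\frac14\,\frac{t(1-t)(y^2-x^2)^2}{y^2-(y^2-x^2)t}\right)^{\alpha}\right)dt\right]dy .$$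
   Context: The right-sided fractional Bessel integral is $$(B_{\nu,-}^{-\alpha}f)(x)=\frac{1}{\Gamma(2\alpha)}\int_x^\infty\left(\frac{y^2-x^2}{2y}\right)^{2\alpha-1}{}_2F_1\left(\alpha+\frac{\nu-1}{2},\alpha;2\alpha;1-\frac{x^2}{y^2}\right)f(y)\,dy,\qquad x>0,$$ where ${}_2F_1$ is the Gauss hypergeometric function; $[2\alpha]$ is the integer part of $2\alpha$. $A^k$ denotes the $k$-fold iterate of this integral operator, applied through the integral formula (in particular $A^k|f|\in[0,\infty]$ is always defined, since the kernel is nonnegative). The multi-index Mittag--Leffler (Wright) function is $$E_{(1/\rho_i),(\mu_i)}(z)=\sum_{k=0}^\infty\frac{z^k}{\Gamma(\mu_1+k/\rho_1)\cdots\Gamma(\mu_m+k/\rho_m)},$$ so that $E_{(\alpha,\alpha),(\alpha,\alpha)}(z)=\sum_{k=0}^\infty\dfrac{z^k}{\Gamma(\alpha+\alpha k)^2}$. The resolvent of a linear operator $A$ is the operator giving the solution $g=R_\lambda f$ of $(A-\lambda I)g=f$, taken here in the form of the Neumann series $R_\lambda f=-\frac1\lambda\sum_{k=0}^\infty\left(\frac1\lambda A\right)^kf$. *)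

(* Defs.v *)
From HB Require Import structures.
From mathcomp Require Import all_boot all_order all_algebra.
From mathcomp Require Import all_classical all_reals all_analysis.
From mathcomp Require Import complex.

Set Implicit Arguments.
Unset Strict Implicit.
Unset Printing Implicit Defensive.

Import Order.TTheory GRing.Theory Num.Theory.
Import numFieldNormedType.Exports.

Local Open Scope classical_set_scope.
Local Open Scope ring_scope.
Local Open Scope complex_scope.

Section ComplexAnalysis.
Context {R : realType}.
Local Notation mu := (@lebesgue_measure R).

Definition cabs (z : R[i]) : R := ComplexField.Normc.normc z.

(* Sum of a complex series; the limit is taken for the topology of the
   modulus, which R[i] carries through its regular alias R[i]^o. *)
Definition csum (u : nat -> R[i]) : R[i] := limn (series (u : (R[i]^o)^nat)).

Definition ccvg_series (u : nat -> R[i]) : Prop :=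
  cvgn (series (u : (R[i]^o)^nat)).

(* A complex-valued function is Lebesgue integrable when its real and
   imaginary parts are; its integral is taken componentwise. *)
Definition cintegrable (D : set R) (f : R -> R[i]) : Prop :=
  mu.-integrable D (fun t => (complex.Re (f t))%:E) /\
  mu.-integrable D (fun t => (complex.Im (f t))%:E).

Definition cintegral (D : set R) (f : R -> R[i]) : R[i] :=
  (\int[mu]_(t in D) complex.Re (f t)) +i* (\int[mu]_(t in D) complex.Im (f t)).

Definition Cn_pos (n : nat) (f : R -> R) : Prop :=
  (forall k x, (k < n)%N -> 0 < x -> derivable (derive1n k f) x 1) /\
  (forall x, 0 < x -> {for x, continuous (derive1n n f)}).

(* C^n(0,+oo) for complex-valued functions; the values of f outside (0,+oo)
   are irrelevant. *)
Definition cCn_pos (n : nat) (f : R -> R[i]) : Prop :=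
  Cn_pos n (fun x => complex.Re (f x)) /\ Cn_pos n (fun x => complex.Im (f x)).

End ComplexAnalysis.

Section SpecialFunctions.
Context {R : realType}.
Local Notation mu := (@lebesgue_measure R).

(* Meaningful for a > 0. *)
Definition Gamma (a : R) : R :=
  \int[mu]_(t in `]0, +oo[) (t `^ (a - 1) * expR (- t)).

Definition rising_fact (a : R) (n : nat) : R := \prod_(i < n) (a + i%:R).

(* Gauss series, meaningful for c > 0 and |z| < 1. *)
Definition hyp2F1 (a b c z : R) : R :=
  limn (series (fun n : nat => rising_fact a n * rising_fact b n
    / (rising_fact c n * n`!%:R) * z ^+ n)).

(* E_{(1/rho_i),(mu_i)}(z), with a i for 1/rho_i and b i for mu_i. *)
Definition multi_mittag_leffler (m : nat) (a b : 'I_m -> R) (z : R[i]) : R[i] :=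
  csum (fun k : nat =>
    z ^+ k / (\prod_(i < m) Gamma (b i + k%:R * a i))%:C).

End SpecialFunctions.

Section FractionalBessel.
Context {R : realType}.
Local Notation mu := (@lebesgue_measure R).
Variables nu alpha : R.

Definition bessel_kernel (x y : R) : R :=
  (Gamma (2 * alpha))^-1
  * ((y ^+ 2 - x ^+ 2) / (2 * y)) `^ (2 * alpha - 1)
  * hyp2F1 (alpha + (nu - 1) / 2) alpha (2 * alpha) (1 - x ^+ 2 / y ^+ 2).

Definition bessel_integrable (f : R -> R[i]) (x : R) : Prop :=
  cintegrable `]x, +oo[ (fun y => (bessel_kernel x y)%:C * f y).

Definition bessel_int (f : R -> R[i]) (x : R) : R[i] :=
  cintegral `]x, +oo[ (fun y => (bessel_kernel x y)%:C * f y).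

(* The same operator on nonnegative functions, with values in [0,+oo]. *)
Definition bessel_int_ge0 (g : R -> \bar R) (x : R) : \bar R :=
  (\int[mu]_(y in `]x, +oo[) ((bessel_kernel x y)%:E * g y))%E.

End FractionalBessel.

Section Resolvent.
Context {R : realType}.
Variables (A : (R -> R[i]) -> R -> R[i]) (lambda : R[i]) (f : R -> R[i]).

(* lambda^{-(k+1)} (A^{k+1} f)(x), so that k >= 0 enumerates the terms of
   index at least 1 of the Neumann series. *)
Definition neumann_term (x : R) (k : nat) : R[i] :=
  lambda ^- k.+1 * iter k.+1 A f x.

Definition neumann_resolvent (x : R) : R[i] :=
  - lambda^-1 * f x - lambda^-1 * csum (neumann_term x).

End Resolvent.

(* Main.v *)
Require Import Defs.
From HB Require Import structures.
From mathcomp Require Import all_boot all_order all_algebra.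
From mathcomp Require Import all_classical all_reals all_analysis.
From mathcomp Require Import complex measurable_realfun ring lra.

Set Implicit Arguments.
Unset Strict Implicit.
Unset Printing Implicit Defensive.

Import Order.TTheory GRing.Theory Num.Theory.
Import numFieldNormedType.Exports.

Local Open Scope classical_set_scope.
Local Open Scope ring_scope.
Local Open Scope complex_scope.

(** The kernel of [A] is a product of two simpler ones.  Euler's integral for
    the Gauss function, after a change of variable, reads
    [K_a(x, y) = 4^(1-a) / Gamma(a)^2 * y^nu * \int_x^y (s^2 - x^2)^(a-1)
      s^(2-2a-nu) (y^2 - s^2)^(a-1) ds],
    so the fractional Bessel integral of order [a] is the composition of two
    Weyl fractional integrals in the square of the variable, each combined with
    a multiplication by a power ([weyl_besselE]).  In the composition of two
    such products, of orders [a] and [b], the reflection [s -> x y / s]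
    exchanges the two middle factors ([weyl_integral_reflection]); what is then
    adjacent composes by the Beta integral ([weyl_integral_beta]).  This gives
    the semigroup law [weyl_bessel_comp], and hence [A^(k+1)] has the kernel
    of order [alpha + k alpha].

    Euler's integrand of order [alpha + k alpha] is the one of order [alpha]
    times the [k]-th power of the ratio that stands in the argument of the
    Mittag-Leffler function, up to the power of [(y^2 - x^2) / (2y)] that stands
    in front of the integral, next to [1 / Gamma(alpha + k alpha)^2].  Summing
    over [k] therefore turns the Neumann series into the announced double
    integral: [inner_integral_series] does so under the integral over [(0, 1)],
    and [mittag_leffler_integral] under the one over [(x, +oo)].
    Applying [A] to the Neumann series term by term shifts it by one index,
    which is the resolvent equation ([resolvent_equation]).

    Every exchange of a sum and an integral rests on absolute convergence.  For
    the integrals over [(x, +oo)] this is the hypothesis on the iterates of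
    [|f|], used in [neumann_exchange]; for the integral over [(0, 1)] it holds
    because [Gamma] grows faster than any exponential ([Gamma_ge]). *)

(** * Change of variables on open intervals, for nonnegative integrands *)

Section Substitution.
Context {R : realType}.
Local Notation mu := (@lebesgue_measure R).
Implicit Types (I : set R) (F dF G : R -> R).

Definition compact_exhaustion I (a b : nat -> R) : Prop :=
  [/\ forall n, a n < b n,
      forall n, a n.+1 <= a n,
      forall n, b n <= b n.+1
    & I = \bigcup_n [set` `[a n, b n]] ].

Lemma exhaustion_sub I a b n :
  compact_exhaustion I a b -> [set` `[a n, b n]] `<=` I.
Proof. by case=> _ _ _ -> x xn; exists n. Qed.

Lemma exhaustion_cvg I a b (G : R -> \bar R) : compact_exhaustion I a b ->
  measurable_fun I G -> (forall x, I x -> (0 <= G x)%E) ->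
  (\int[mu]_(x in `[a n, b n]) G x)%E @[n --> \oo]
    --> (\int[mu]_(x in I) G x)%E.
Proof.
move=> ex mG G0; have sub n := exhaustion_sub (n := n) ex.
case: ex => ab ad bi IE; rewrite IE.
have mI : measurable I.
  by rewrite IE; apply: bigcupT_measurable => n; exact: measurable_itv.
apply: ge0_nondecreasing_set_cvg_integral.
- apply/nondecreasing_seqP => n; rewrite subsetEset => x /=.
  rewrite !in_itv/= => /andP[ax xb].
  by rewrite (le_trans (ad n) ax) (le_trans xb (bi n)).
- by move=> n; exact: measurable_itv.
- by move=> n; apply: measurable_funS mG.
- by move=> n x /sub; exact: G0.
Qed.

Lemma derivable_near I F dF x : open I -> I x ->
  (forall y, I y -> is_derive y 1 F (dF y)) ->
  {for x, continuous dF} -> {for x, continuous (F^`())%classic}.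
Proof.
move=> oI Ix dFI cF.
have E y : I y -> (F^`())%classic y = dF y.
  by move=> Iy; rewrite derive1E; have := dFI _ Iy => ?; rewrite derive_val.
rewrite /prop_for/continuous_at (E _ Ix).
apply: cvg_trans cF; apply: near_eq_cvg.
have : \forall z \near x, I z by exact: open_nbhs_nbhs.
by apply: filterS => z /E.
Qed.

Lemma subst_side_conditions I F dF a b : open I -> a < b ->
  [set` `[a, b]] `<=` I ->
  (forall y, I y -> is_derive y 1 F (dF y)) ->
  (forall y, I y -> {for y, continuous dF}) ->
  [/\ {in `]a, b[, continuous (F^`())%classic},
      cvg ((F^`())%classic x @[x --> a^'+]),
      cvg ((F^`())%classic x @[x --> b^'-]),
      derivable_oo_LRcontinuous F a b
    & {within `[a, b], continuous F} ].
Proof.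
move=> oI ab sub dFI cdF.
have cF' x : I x -> {for x, continuous (F^`())%classic}.
  by move=> Ix; apply: (derivable_near oI Ix dFI); exact: cdF.
have cF x : I x -> {for x, continuous F}.
  move=> Ix; apply: differentiable_continuous; apply/derivable1_diffP.
  by have := dFI _ Ix => ?.
have Ia : I a by apply: sub; rewrite /= in_itv/= lexx ltW.
have Ib : I b by apply: sub; rewrite /= in_itv/= lexx ltW.
split.
- move=> x; rewrite in_itv/= => /andP[ax xb]; apply: cF'; apply: sub.
  by rewrite /= in_itv/= !ltW.
- by apply/cvg_ex; exists ((F^`())%classic a); apply: cvg_at_right_filter; exact: cF'.
- by apply/cvg_ex; exists ((F^`())%classic b); apply: cvg_at_left_filter; exact: cF'.
- split.
  + move=> x; rewrite in_itv/= => /andP[ax xb].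
    have Ix : I x by apply: sub; rewrite /= in_itv/= !ltW.
    by have := dFI _ Ix => ?.
  + by apply: cvg_at_right_filter; exact: cF.
  + by apply: cvg_at_left_filter; exact: cF.
- by apply: continuous_in_subspaceT => x /[!inE] /sub; exact: cF.
Qed.

Lemma measurable_fun_open_cont I G : open I ->
  (forall x, I x -> {for x, continuous G}) -> measurable_fun I G.
Proof.
move=> oI cG; apply: open_continuous_measurable_fun => //.
by move=> x /[!inE]; exact: cG.
Qed.

(** The integrands met below are singular at both ends of their interval.  The
    substitution is done on an increasing sequence of segments, where all
    functions are continuous, and passed to the limit by monotone
    convergence. *)
Lemma ge0_substitution_incr I F dF G a b : compact_exhaustion I a b ->
  open I ->
  (forall x, I x -> is_derive x 1 F (dF x)) ->
  (forall x, I x -> {for x, continuous dF}) ->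
  (forall x, I x -> 0 <= dF x) ->
  (forall x y, I x -> I y -> x < y -> F x < F y) ->
  open (F @` I) ->
  (forall y, (F @` I) y -> {for y, continuous G}) ->
  (forall y, (F @` I) y -> 0 <= G y) ->
  (\int[mu]_(y in F @` I) (G y)%:E = \int[mu]_(x in I) (G (F x) * dF x)%:E)%E.
Proof.
move=> ex oI dFI cdF dF0 incF oJ cG G0.
have sub n := exhaustion_sub (n := n) ex.
have ex0 := ex; case: ex => ab ad bi IE.
have Ia n : I (a n) by apply: (sub n); rewrite /= in_itv/= lexx ltW.
have Ib n : I (b n) by apply: (sub n); rewrite /= in_itv/= lexx ltW.
have incF' x y : I x -> I y -> x <= y -> F x <= F y.
  by move=> Ix Iy; rewrite le_eqVlt => /predU1P[->//|/(incF _ _ Ix Iy)/ltW].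
have exJ : compact_exhaustion (F @` I) (F \o a) (F \o b).
  split => /= [n|n|n|]; [exact: incF|exact: incF'|exact: incF'|].
  apply/seteqP; split => [_ [x + <-]|y [n _ /=]].
    move=> Ix; move: (Ix); rewrite {1}IE => -[n _ /=]; rewrite in_itv/= => /andP[ax xb].
    by exists n => //=; rewrite in_itv/= !incF'.
  rewrite in_itv/= => /andP[ay yb].
  have [_ _ _ _ cF] := subst_side_conditions oI (ab n) (sub n) dFI cdF.
  have [] := @IVT R F (a n) (b n) y (ltW (ab n)) cF.
    by rewrite ge_min ay /= le_max yb orbT.
  by move=> c /(sub n) Ic <-; exists c.
have cF x : I x -> {for x, continuous F}.
  move=> Ix; apply: differentiable_continuous; apply/derivable1_diffP.
  by have := dFI _ Ix => ?.
have H1 := exhaustion_cvg exJ (G := EFin \o G).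
have H2 := exhaustion_cvg ex0 (G := fun x => (G (F x) * dF x)%:E).
have mG : measurable_fun (F @` I) (EFin \o G).
  by apply/measurable_EFinP; exact: measurable_fun_open_cont.
have {}H1 := H1 mG.
have {}H1 := H1 (fun x Jx => G0 x Jx).
have mH : measurable_fun I (fun x => (G (F x) * dF x)%:E).
  apply/measurable_EFinP; apply: measurable_fun_open_cont => // x Ix.
  apply: cvgM; last exact: cdF.
  by apply: (@continuous_comp _ _ _ F G); [exact: cF|apply: cG; exists x].
have {}H2 := H2 mH (fun x Ix => mulr_ge0 (G0 _ (ex_intro2 _ _ x Ix erefl)) (dF0 x Ix)).
apply: (cvg_unique _ H1); first exact: ereal_hausdorff.
apply: cvg_trans H2; apply: near_eq_cvg; apply: nearW => n /=.
have [c1 c2 c3 c4 c5] := subst_side_conditions oI (ab n) (sub n) dFI cdF.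
rewrite (integration_by_substitution_increasing (ltW (ab n)) _ c1 c2 c3 c4).
- apply: eq_integral => x /[!inE] /sub Ix /=; congr EFin.
  by rewrite /GRing.mul/= derive1E; have := dFI _ Ix => ?; rewrite derive_val.
- by move=> x y /sub Ix /sub Iy; exact: incF.
- apply: continuous_in_subspaceT => y /[!inE] yn; apply: cG.
  by case: exJ => _ _ _ ->; exists n.
Qed.

Lemma ge0_integral_reflection (D : set R) (G : R -> \bar R) : measurable D ->
  measurable_fun D G -> (forall y, D y -> (0 <= G y)%E) ->
  (\int[mu]_(y in D) G y = \int[mu]_(x in -%R @^-1` D) G (- x)%R)%E.
Proof.
move=> mD mG G0.
have := @ge0_integral_pushforward _ _ (measurableTypeR R) (measurableTypeR R) R -%R
  _ mu D G mD mG.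
rewrite /= => <-; last by move=> y /[!inE]; exact: G0.
  by apply: eq_measure_integral => //= A mA AS; exact/esym/lebesgue_measureN.
exact: oppr_measurable.
Qed.

(** Reflecting the variable of the left-hand integral makes the change of
    variable increasing. *)
Lemma ge0_substitution_decr I F dF G a b : compact_exhaustion I a b ->
  open I ->
  (forall x, I x -> is_derive x 1 F (dF x)) ->
  (forall x, I x -> {for x, continuous dF}) ->
  (forall x, I x -> dF x <= 0) ->
  (forall x y, I x -> I y -> x < y -> F y < F x) ->
  open (F @` I) ->
  (forall y, (F @` I) y -> {for y, continuous G}) ->
  (forall y, (F @` I) y -> 0 <= G y) ->
  (\int[mu]_(y in F @` I) (G y)%:E = \int[mu]_(x in I) (G (F x) * - dF x)%:E)%E.
Proof.
move=> ex oI dFI cdF dF0 decF oJ cG G0.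
have E : -%R @^-1` (F @` I) = (fun x => - F x) @` I.
  apply/seteqP; split => [y [x Ix /eqP]|y [x Ix <-]] /=.
    by rewrite -eqr_oppLR => /eqP <-; exists x.
  by exists x => //; rewrite opprK.
rewrite ge0_integral_reflection; first last.
- by move=> y /G0.
- by apply/measurable_EFinP; exact: measurable_fun_open_cont.
- exact: open_measurable.
rewrite E.
have dNF x : I x -> is_derive x 1 (fun x => - F x) (- dF x).
  by move=> Ix; have := dFI _ Ix => ?; exact: is_deriveN.
rewrite [LHS](ge0_substitution_incr (G := fun y => G (- y)) ex oI dNF) //.
- by apply: eq_integral => x _; rewrite opprK.
- by move=> x Ix; apply: cvgN; exact: cdF.
- by move=> x /dF0; rewrite oppr_ge0.
- by move=> x y Ix Iy xy; rewrite ltrN2; exact: decF.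
- rewrite -E; have cN : continuous (fun x : R => - x).
    by move=> x; exact: opp_continuous.
  by move/continuousP : cN; exact.
- move=> y; rewrite -E /= => Jy.
  by apply: (@continuous_comp _ _ _ -%R G); [exact: opp_continuous|exact: cG].
- by move=> y; rewrite -E /=; exact: G0.
Qed.

Lemma itvoo_exhaustion (x y : R) : x < y ->
  exists a b, compact_exhaustion `]x, y[ a b.
Proof.
move=> xy; pose e n : R := (y - x) / n.+3%:R.
have yx0 : 0 < y - x by rewrite subr_gt0.
have e0 n : 0 < e n by rewrite divr_gt0.
have eS n : e n.+1 <= e n.
  by rewrite ler_pM2l// lef_pV2 ?posrE// ler_nat.
have e3 n : e n < (y - x) / 2 by rewrite ltr_pM2l// ltf_pV2 ?posrE// ltr_nat.
(* e 0 = (y - x) / 3, so that already the first segment is proper *)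
exists (fun n => x + e n), (fun n => y - e n); split => [n|n|n|].
- by have := e3 n; lra.
- by rewrite lerD2l.
- by rewrite lerD2l lerN2.
apply/seteqP; split => [z|z [n _]] /=; last first.
  by rewrite !in_itv/=; have := e0 n; lra.
rewrite in_itv/= => /andP[xz zy].
pose d := Num.min (z - x) (y - z).
have d0 : 0 < d by rewrite lt_min !subr_gt0 xz.
have [n nd] : exists n, e n < d.
  exists (Num.truncn ((y - x) / d)).
  rewrite /e ltr_pdivrMr// mulrC -ltr_pdivrMr//.
  by apply: (lt_le_trans (truncnS_gt _)); rewrite ler_nat ltnS; apply/leqW/leqW.
exists n => //=; rewrite in_itv/=; move: nd; rewrite lt_min => /andP[]; lra.
Qed.

Lemma itv0y_exhaustion : exists a b, compact_exhaustion (`]0, +oo[ : set R) a b.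
Proof.
exists (fun n => n.+2%:R^-1), (fun n => n.+2%:R); split => [n|n|n|].
- rewrite (@lt_trans _ _ 1)// ?ltr1n//.
  by rewrite invf_lt1// ltr1n.
- by rewrite lef_pV2 ?posrE// ler_nat.
- by rewrite ler_nat.
apply/seteqP; split => [z|z [n _]] /=; last first.
  by rewrite !in_itv/= andbT => /andP[+ _]; apply: lt_le_trans; rewrite invr_gt0.
rewrite in_itv/= andbT => z0.
pose n := maxn (Num.truncn z) (Num.truncn z^-1).
exists n => //=; rewrite in_itv/=; apply/andP; split.
- rewrite -[leRHS]invrK lef_pV2 ?posrE ?invr_gt0//.
  apply: le_trans (ltW (truncnS_gt _)) _.
  by rewrite ler_nat ltnS ltnW// ltnS leq_maxr.
- apply: le_trans (ltW (truncnS_gt _)) _.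
  by rewrite ler_nat ltnS ltnW// ltnS leq_maxl.
Qed.

(** Extension by zero outside the rectangle reduces this to the plane. *)
Lemma ge0_tonelli_in (D E : set R) (f : R -> R -> \bar R) :
  measurable D -> measurable E ->
  measurable_fun setT (fun z : R * R => f z.1 z.2) ->
  (forall x y, D x -> E y -> (0 <= f x y)%E) ->
  (\int[mu]_(x in D) \int[mu]_(y in E) f x y =
   \int[mu]_(y in E) \int[mu]_(x in D) f x y)%E.
Proof.
move=> mD mE mf f0.
pose g := (fun z : R * R => f z.1 z.2) \_ (D `*` E).
have mg : measurable_fun setT g.
  apply/(measurable_restrictT (fun z : R * R => f z.1 z.2)).
    exact: measurableX.
  exact: measurable_funTS.
have g0 z : (0 <= g z)%E.
  by apply: erestrict_ge0 => -[x y] /= [Dx Ey]; exact: f0.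
have gE x y : g (x, y) = if (x \in D) && (y \in E) then f x y else 0%E.
  by rewrite /g patchE in_setX.
transitivity (\int[mu]_x \int[mu]_y g (x, y))%E.
  rewrite integral_mkcond; apply: eq_integral => x _; rewrite patchE.
  case: ifPn => xD; last by rewrite integral0_eq// => y _; rewrite gE (negbTE xD).
  rewrite integral_mkcond; apply: eq_integral => y _.
  by rewrite patchE gE xD.
rewrite [LHS](@fubini_tonelli _ _ (measurableTypeR R) (measurableTypeR R) R mu mu g mg g0).
rewrite [RHS]integral_mkcond; apply: eq_integral => y _; rewrite patchE.
case: ifPn => yE; last by rewrite integral0_eq// => x _; rewrite gE (negbTE yE) andbF.
rewrite [RHS]integral_mkcond; apply: eq_integral => x _.
by rewrite patchE gE yE andbT.
Qed.

End Substitution.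

(** * The Gamma function and the Beta integral *)

Section Gamma.
Context {R : realType}.
Local Notation mu := (@lebesgue_measure R).

Lemma powR_continuous_at (p x : R) :
  0 < x -> {for x, continuous (@powR R ^~ p)}.
Proof.
move=> x0; apply: differentiable_continuous; apply/derivable1_diffP.
by apply: derivable_powR; rewrite in_itv/= x0.
Qed.

Lemma powRB1 (x p : R) : 0 < x -> x `^ (p - 1) = x `^ p / x.
Proof.
move=> x0; rewrite powRB ?powRr1 ?ltW//.
by apply/implyP => _; rewrite gt_eqF.
Qed.

Lemma powRDp (x p q : R) : 0 < x -> x `^ (p + q) = x `^ p * x `^ q.
Proof.
by move=> x0; rewrite powRD//; apply/implyP => _; rewrite gt_eqF.
Qed.

(** Finiteness comes with the value: an infinite integral would make the product
    infinite. *)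
Lemma mule_solve (c d : R) (I : \bar R) :
  0 < c -> (c%:E * I = d%:E)%E -> (I = (d / c)%:E)%E.
Proof.
move=> c0; case: I => [r| |].
- by rewrite -EFinM => -[<-]; rewrite mulrC mulKf// gt_eqF.
- by rewrite gt0_muley ?lte_fin.
- by rewrite gt0_muleNy ?lte_fin.
Qed.

Lemma lebesgue_itvoo (x y : R) : x < y -> mu `]x, y[ = (y - x)%:E.
Proof.
move=> xy; apply: etrans (lebesgue_measure_itv _) _.
by rewrite /= lte_fin xy.
Qed.

Lemma integral_cst_itvoo (x y c : R) : x < y ->
  (\int[mu]_(t in `]x, y[) c%:E = (c * (y - x))%:E)%E.
Proof.
move=> xy; apply: etrans (integral_cst mu (measurable_itv _) c%:E) _.
by rewrite EFinM; congr (_ * _)%E; exact: lebesgue_itvoo.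
Qed.

Lemma powR_lt1 (x a : R) : 0 < x < 1 -> 0 < a -> x `^ a < 1.
Proof.
move=> /andP[x0 x1] a0; have <- : 1 `^ a = 1 by rewrite powR1.
by rewrite gt0_ltr_powR// nnegrE ltW.
Qed.

Lemma integral01_1 : (\int[mu]_(t in `]0%R, 1%R[) (1 : R)%:E = 1)%E.
Proof.
by rewrite integral_cst_itvoo// subr0 mulr1.
Qed.

(** The substitution [s = t^a] turns the integral of [a t^(a-1)] into the length
    of the unit interval. *)
Lemma integral01_powR (a : R) : 0 < a ->
  (\int[mu]_(t in `]0%R, 1%R[) (t `^ (a - 1))%:E = (a^-1)%:E)%E.
Proof.
move=> a0; have [u [v ex]] := itvoo_exhaustion (ltr01 : 0 < 1 :> R).
rewrite -[a^-1]mul1r; apply: mule_solve => //.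
rewrite -ge0_integralZl_EFin ?ltW//; last 2 first.
- by move=> x _; rewrite lee_fin powR_ge0.
- by apply/measurable_EFinP; apply: measurable_funTS; exact: measurable_powR.
have E : (powR (R := R) ^~ a) @` (`]0, 1[ : set R) = `]0, 1[%classic :> set R.
  apply/seteqP; split => [_ [x /= xI <-]|x /=]; last rewrite in_itv/= => /andP[x0 x1].
    move: xI; rewrite !in_itv/= => /andP[x0 x1].
    by rewrite powR_gt0//= powR_lt1// x0.
  exists (x `^ a^-1); last by rewrite -powRrM mulVf ?gt_eqF// powRr1 ?ltW.
  by rewrite /= in_itv/= powR_gt0//= powR_lt1 ?invr_gt0// x0.
have oI : open (`]0, 1[%classic : set R) by exact: interval_open.
have dd (x : R) : `]0, 1[%classic x ->
    is_derive x 1 (powR (R := R) ^~ a) (a * x `^ (a - 1)).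
  by rewrite /= in_itv/= => /andP[x0 _]; exact: is_derive1_powR.
have := ge0_substitution_incr (G := cst 1) ex oI dd.
rewrite E integral01_1 => ->; last 6 first.
- move=> x; rewrite /= in_itv/= => /andP[x0 _].
  by apply: cvgM; [exact: cvg_cst|exact: powR_continuous_at].
- by move=> x _; rewrite mulr_ge0 ?powR_ge0// ltW.
- move=> x y; rewrite /= !in_itv/= => /andP[x0 _] /andP[y0 _] xy.
  by rewrite gt0_ltr_powR// nnegrE ltW.
- exact: interval_open.
- by move=> y _; exact: cvg_cst.
- by move=> y _.
by apply: eq_integral => x _; rewrite /= mul1r EFinM.
Qed.

(** Kept in the extended reals, since the integral is manipulated before it is
    known to be finite. *)
Definition beta_integral (a b : R) : \bar R :=
  (\int[mu]_(t in `]0%R, 1%R[) (t `^ (a - 1) * (1 - t) `^ (b - 1))%:E)%E.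

Lemma beta_integral_1 (a : R) : 0 < a -> beta_integral a 1 = (a^-1)%:E.
Proof.
move=> a0; rewrite -integral01_powR//; apply: eq_integral => t _.
by rewrite subrr powRr0 mulr1.
Qed.

(** The substitution is [r = t / (1 - t)]. *)
Lemma beta_integral_0y (a b : R) :
  (\int[mu]_(r in `]0%R, +oo[) (r `^ (a - 1) * (1 + r) `^ (- (a + b)))%:E
   = beta_integral a b)%E.
Proof.
have [u [v ex]] := itvoo_exhaustion (ltr01 : 0 < 1 :> R).
pose F (t : R) := (1 - t)^-1 - 1; pose dF (t : R) := (1 - t) ^- 2.
have cV (x : R) : x < 1 -> {for x, continuous (fun t : R => (1 - t)^-1)}.
  move=> x1; apply: cvgV; first by rewrite subr_eq0 gt_eqF.
  by apply: cvgB; [exact: cvg_cst|exact: cvg_id].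
have E : F @` (`]0, 1[ : set R) = `]0, +oo[%classic :> set R.
  apply/seteqP; split => [_ [x /= xI <-]|x /=]; last rewrite in_itv/= ?andbT.
    move: xI; rewrite !in_itv/= ?andbT.
    by move=> /andP[x0 x1]; rewrite subr_gt0 invf_gt1 ?subr_gt0// gtrBl.
  move=> x0; have x1 : 0 < 1 + x by rewrite addr_gt0.
  have x10 : 1 + x != 0 by rewrite gt_eqF.
  exists (x / (1 + x)); last by rewrite /F; field; apply/andP; split => //; lra.
  by rewrite /= in_itv/= divr_gt0//= ltr_pdivrMr// mul1r ltrDr.
have oI : open (`]0, 1[%classic : set R) by exact: interval_open.
have dd (x : R) : `]0, 1[%classic x -> is_derive x 1 F (dF x).
  rewrite /= in_itv/= => /andP[x0 x1]; rewrite /F /dF.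
  have d1 : is_derive x 1 (fun t : R => 1 - t) (-1).
    by apply: is_derive_eq; ring.
  have d2 := is_deriveV (_ : (fun t : R => 1 - t) x != 0) d1.
  apply: is_derive_eq.
    apply: is_deriveB; apply: d2.
    by rewrite subr_eq0 gt_eqF.
  by rewrite subr0 /GRing.scale/= mulNr mulrN1 opprK.
rewrite -E (ge0_substitution_incr ex oI dd) ?E; last 6 first.
- move=> x; rewrite /= in_itv/= => /andP[x0 x1].
  have -> : dF = (fun t => (1 - t)^-1 * (1 - t)^-1).
    by apply/funext => t; rewrite /dF expr2 invfM.
  by apply: cvgM; exact: cV.
- move=> x _; rewrite /dF invr_ge0 sqr_ge0//.
- move=> x y; rewrite /= !in_itv/= => /andP[x0 x1] /andP[y0 y1] xy.
  by rewrite /F ltrD2r ltf_pV2 ?posrE ?subr_gt0// ltrD2l ltrN2.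
- exact: interval_open.
- move=> y; rewrite /= in_itv/= andbT => y0; apply: cvgM.
    exact: powR_continuous_at.
  apply: (@continuous_comp _ _ _ (fun r : R => 1 + r) (powR (R := R) ^~ (- (a + b)))).
    by apply: cvgD; [exact: cvg_cst|exact: cvg_id].
  by apply: powR_continuous_at; rewrite addr_gt0.
- by move=> y _; rewrite mulr_ge0 ?powR_ge0.
apply: eq_integral => t; rewrite inE/= in_itv/= => /andP[t0 t1]; congr EFin.
have t1' : 0 < 1 - t by rewrite subr_gt0.
have -> : F t = t * (1 - t)^-1 by rewrite /F; field; rewrite gt_eqF.
have -> : 1 + t / (1 - t) = (1 - t)^-1 by field; rewrite gt_eqF.
have -> : dF t = (1 - t) `^ (- 2%:R) by rewrite powR_invn// ltW.
rewrite powRM ?ltW ?invr_gt0// -powR_inv1 ?ltW// -!powRrM -!mulrA -!powRDp//.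
by congr (_ * _ `^ _); ring.
Qed.

(** One term of the exponential series at [1 + t] is enough. *)
Lemma expR_powR_bound (m : nat) (t : R) : 0 <= t ->
  expR (- t) <= m.+1`!%:R * expR 1 * (1 + t) ^- m.+1.
Proof.
move=> t0; have t1 : 0 < 1 + t by rewrite ltr_pwDl.
rewrite ler_pdivlMr ?exprn_gt0// mulrC.
have := expR_ge1Dxn m (ltW t1).
rewrite expRD => h.
have {}h : (1 + t) ^+ m.+1 <= m.+1`!%:R * (expR 1 * expR t).
  rewrite -ler_pdivrMl ?ltr0n ?fact_gt0//; apply: le_trans h.
  by rewrite mulrC lerDr.
rewrite -ler_pdivlMr ?expR_gt0// -expRN opprK -mulrA.
exact: h.
Qed.

Lemma measurable_Gamma_integrand (a c : R) (D : set R) :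
  measurable_fun D (fun t : R => t `^ (a - 1) * expR (- (c * t))).
Proof.
apply: measurable_funTS; apply: measurable_funM; first exact: measurable_powR.
apply: measurableT_comp => //; apply: measurableT_comp => //.
Qed.

Lemma measurable_Gamma_integrand1 (a : R) (D : set R) :
  measurable_fun D (fun t : R => t `^ (a - 1) * expR (- t)).
Proof.
rewrite (_ : (fun t => _) = (fun t : R => t `^ (a - 1) * expR (- (1 * t)))).
  exact: measurable_Gamma_integrand.
by apply/funext => t; rewrite mul1r.
Qed.

(** The point is that the integral is finite: by [expR_powR_bound] the integrand
    is at most a multiple of [t^(a-1) (1+t)^-(a+1)], whose integral is the Beta
    integral at [(a, 1)]. *)
Lemma Gamma_integralE (a : R) : 0 < a ->
  (\int[mu]_(t in `]0%R, +oo[) (t `^ (a - 1) * expR (- t))%:E = (Gamma a)%:E)%E.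
Proof.
move=> a0; rewrite /Gamma /Rintegral fineK//.
rewrite ge0_fin_numE; last first.
  by apply: integral_ge0 => t _; rewrite lee_fin mulr_ge0 ?powR_ge0 ?expR_ge0.
(* M + 1 is an integer above a + 1 *)
pose M := Num.truncn (a + 1).
pose C : R := M.+1`!%:R * expR 1.
have C0 : 0 <= C by rewrite mulr_ge0 ?expR_ge0.
apply: (@le_lt_trans _ _ (\int[mu]_(t in `]0%R, +oo[)
   (C%:E * (t `^ (a - 1) * (1 + t) `^ (- (a + 1)))%:E))%E).
  apply: ge0_le_integral => //.
  - by move=> t _; rewrite lee_fin mulr_ge0 ?powR_ge0 ?expR_ge0.
  - by apply/measurable_EFinP; exact: measurable_Gamma_integrand1.
  - apply/measurable_EFinP; apply: measurable_funM => //.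
    apply: measurable_funTS; apply: measurable_funM; first exact: measurable_powR.
    apply: (measurableT_comp (measurable_powR _)) => //.
    exact: measurable_funD.
  - move=> t; rewrite /= in_itv/= andbT => t0; rewrite lee_fin mulrCA.
    rewrite ler_wpM2l ?powR_ge0// (le_trans (expR_powR_bound M (ltW t0)))//.
    rewrite ler_wpM2l// -powR_invn; last by rewrite addr_ge0 ?ltW.
    rewrite ler_powR//; first by rewrite lerDl ltW.
    by rewrite lerN2 ltW// truncnS_gt.
rewrite ge0_integralZl_EFin//; last 2 first.
- by move=> t _; rewrite lee_fin mulr_ge0 ?powR_ge0.
- apply/measurable_EFinP.
  apply: measurable_funTS; apply: measurable_funM; first exact: measurable_powR.
  apply: (measurableT_comp (measurable_powR _)) => //.
  exact: measurable_funD.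
by rewrite beta_integral_0y beta_integral_1// -EFinM ltry.
Qed.

(** Only the part of the integral over [(T, T+1)] is kept.  As [T] is free,
    [Gamma] outgrows every exponential, which is what the convergence of the
    Mittag-Leffler series asks for. *)
Lemma Gamma_ge (a T : R) : 0 < a -> 0 < T ->
  T `^ a / (T + 1) * expR (- (T + 1)) <= Gamma a.
Proof.
move=> a0 T0; rewrite -lee_fin -Gamma_integralE//.
set c := (X in (X%:E <= _)%E).
apply: (@le_trans _ _ (\int[mu]_(t in `]T, (T + 1)%R[) c%:E)%E).
  by rewrite integral_cst_itvoo ?ltrDl// [T + 1]addrC addrK mulr1.
have mf : measurable_fun (`]0, +oo[%classic : set R) (fun t : R => (t `^ (a - 1) * expR (- t))%:E).
  by apply/measurable_EFinP; exact: measurable_Gamma_integrand1.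
have sub : `]T, (T + 1)%R[%classic `<=` `]0, +oo[%classic.
  by move=> t /=; rewrite !in_itv/= andbT => /andP[+ _]; exact: lt_trans.
apply: (@le_trans _ _ (\int[mu]_(t in `]T, (T + 1)%R[)
    (t `^ (a - 1) * expR (- t))%:E)%E); last first.
  apply: ge0_subset_integral => //.
  by move=> t _; rewrite lee_fin mulr_ge0 ?powR_ge0 ?expR_ge0.
apply: ge0_le_integral => //.
- by move=> t _; rewrite lee_fin /c mulr_ge0 ?expR_ge0// divr_ge0 ?powR_ge0// addr_ge0 ?ltW.
- exact: measurable_funS mf.
- move=> t; rewrite /= in_itv/= => /andP[Tt t1]; rewrite lee_fin.
  have t0 : 0 < t by exact: lt_trans Tt.
  apply: ler_pM; rewrite ?expR_ge0//.
  + by rewrite divr_ge0 ?powR_ge0// addr_ge0 ?ltW.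
  + rewrite powRB1// ler_pM ?powR_ge0 ?invr_ge0//.
    * by rewrite addr_ge0 ?ltW.
    * by rewrite ge0_ler_powR ?nnegrE ?ltW.
    * by rewrite lef_pV2 ?posrE ?addr_gt0// ltW.
  + by rewrite ler_expR lerN2 ltW.
Qed.

Lemma Gamma_gt0 (a : R) : 0 < a -> 0 < Gamma a.
Proof.
move=> a0; apply: lt_le_trans (Gamma_ge a0 ltr01).
by rewrite mulr_gt0 ?expR_gt0// divr_gt0 ?powR_gt0.
Qed.

(** The substitution [s = 1 - exp(-t)] leaves the length of the unit
    interval. *)
Lemma Gamma_1 : Gamma 1 = 1 :> R.
Proof.
apply: EFin_inj; rewrite -Gamma_integralE//.
have [u [v ex]] := @itv0y_exhaustion R.
pose F (t : R) := 1 - expR (- t); pose dF (t : R) := expR (- t).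
have E : F @` (`]0, +oo[ : set R) = `]0, 1[%classic :> set R.
  apply/seteqP; split => [_ [x /= xI <-]|x /=]; last rewrite in_itv/= ?andbT.
    move: xI; rewrite !in_itv/= ?andbT.
    by move=> x0; rewrite /F subr_gt0 expR_lt1 oppr_lt0 x0 gtrBl expR_gt0.
  move=> /andP[x0 x1]; exists (- ln (1 - x)); last first.
    by rewrite /F opprK lnK ?posrE ?subr_gt0// subKr.
  by rewrite /= in_itv/= andbT oppr_gt0 ln_lt0// subr_gt0 x1 gtrBl.
have de (x : R) : is_derive x 1 (fun t : R => expR (- t)) (- expR (- x)).
  have d1 : is_derive x 1 (fun t : R => - t) (-1) by exact: is_deriveN.
  have := @is_derive1_comp R expR -%R x _ _ (is_derive_expR _) d1.
  by rewrite mulrN1.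
have cE (x : R) : {for x, continuous dF}.
  apply: differentiable_continuous; apply/derivable1_diffP.
  by have := de x => ?.
have oI : open (`]0, +oo[%classic : set R) by exact: interval_open.
have dd (x : R) : `]0, +oo[%classic x -> is_derive x 1 F (dF x).
  move=> _; rewrite /F /dF; have := de x => ?.
  by apply: is_derive_eq; ring.
rewrite -integral01_1 -E.
rewrite [RHS](ge0_substitution_incr (G := cst 1) ex oI dd) ?E; last 6 first.
- by move=> x _.
- by move=> x _; rewrite expR_ge0.
- by move=> x y _ _ xy; rewrite /F ltrD2l ltrN2 ltr_expR ltrN2.
- exact: interval_open.
- by move=> x _; exact: cvg_cst.
- by move=> x _.
by apply: eq_integral => t _; rewrite subrr powRr0.
Qed.

Lemma Gamma_scale (a c : R) : 0 < a -> 0 < c ->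
  (\int[mu]_(t in `]0%R, +oo[) (t `^ (a - 1) * expR (- (c * t)))%:E
   = (Gamma a * c `^ (- a))%:E)%E.
Proof.
move=> a0 c0; rewrite powRN; apply: mule_solve; first exact: powR_gt0.
rewrite -ge0_integralZl_EFin ?powR_ge0//; last 2 first.
- by move=> x _; rewrite lee_fin mulr_ge0 ?powR_ge0 ?expR_ge0.
- by apply/measurable_EFinP; exact: measurable_Gamma_integrand.
have [u [v ex]] := @itv0y_exhaustion R.
have E : (fun t => c * t) @` (`]0, +oo[ : set R) = `]0, +oo[%classic :> set R.
  apply/seteqP; split => [_ [x /= xI <-]|x /=]; last rewrite in_itv/= ?andbT.
    move: xI; rewrite !in_itv/= ?andbT.
    by move=> x0; rewrite mulr_gt0.
  move=> x0; exists (c^-1 * x); last by rewrite mulVKf// gt_eqF.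
  by rewrite /= in_itv/= andbT mulr_gt0// invr_gt0.
have oI : open (`]0, +oo[%classic : set R) by exact: interval_open.
have dd (x : R) : `]0, +oo[%classic x -> is_derive x 1 (fun t => c * t) (cst c x).
  by move=> _; apply: is_derive_eq; rewrite /GRing.scale/= mulr1.
rewrite -Gamma_integralE// -[in RHS]E.
rewrite [RHS](ge0_substitution_incr ex oI dd
   (G := fun t => t `^ (a - 1) * expR (- t))) ?E; last 6 first.
- by move=> x _; exact: cvg_cst.
- by move=> x _; rewrite ltW.
- by move=> x y _ _ xy; rewrite ltr_pM2l.
- exact: interval_open.
- move=> y; rewrite /= in_itv/= andbT => y0; apply: cvgM.
    exact: powR_continuous_at.
  apply: (@continuous_comp _ _ _ (fun r : R => - r) expR).
    exact: opp_continuous.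
  exact: continuous_expR.
- by move=> x _; rewrite mulr_ge0 ?powR_ge0 ?expR_ge0.
apply: eq_integral => t; rewrite inE/= in_itv/= andbT => t0; rewrite -EFinM.
congr EFin; rewrite powRM ?ltW// !powRB1//.
by rewrite /cst; field; rewrite !gt_eqF.
Qed.

(** [Gamma(a+b) (1+r)^-(a+b)] is itself a Gamma integral, of
    [s^(a+b-1) exp(-(1+r)s)]; after exchanging the integrals in [r] and [s],
    the two variables separate into [Gamma(a)] and [Gamma(b)]. *)
Lemma beta_integralE (a b : R) : 0 < a -> 0 < b ->
  beta_integral a b = (Gamma a * Gamma b / Gamma (a + b))%:E.
Proof.
move=> a0 b0; have ab0 : 0 < a + b by rewrite addr_gt0.
apply: mule_solve; first exact: Gamma_gt0.
rewrite -beta_integral_0y -ge0_integralZl_EFin ?(ltW (Gamma_gt0 _))//; last 2 first.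
- by move=> x _; rewrite lee_fin mulr_ge0 ?powR_ge0.
- apply/measurable_EFinP.
  apply: measurable_funTS; apply: measurable_funM; first exact: measurable_powR.
  apply: (measurableT_comp (measurable_powR _)) => //.
  exact: measurable_funD.
pose f (r s : R) : \bar R :=
  (r `^ (a - 1) * (s `^ (a + b - 1) * expR (- ((1 + r) * s))))%:E.
have f0 r s : (0 <= f r s)%E by rewrite lee_fin !mulr_ge0 ?powR_ge0 ?expR_ge0.
transitivity (\int[mu]_(r in `]0%R, +oo[) \int[mu]_(s in `]0%R, +oo[) f r s)%E.
  apply: eq_integral => r; rewrite inE/= in_itv/= andbT => r0.
  rewrite /f; under [RHS]eq_integral do rewrite EFinM.
  rewrite ge0_integralZl_EFin ?powR_ge0//; last 2 first.
  - by move=> s _; rewrite lee_fin mulr_ge0 ?powR_ge0 ?expR_ge0.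
  - by apply/measurable_EFinP; exact: measurable_Gamma_integrand.
  by rewrite Gamma_scale ?addr_gt0// -!EFinM; congr EFin; ring.
rewrite ge0_tonelli_in//; last first.
  apply/measurable_EFinP; apply: measurable_funM.
    by apply: (measurableT_comp (measurable_powR _)); exact: measurable_fst.
  apply: measurable_funM.
    by apply: (measurableT_comp (measurable_powR _)); exact: measurable_snd.
  apply: measurableT_comp => //; apply: measurableT_comp => //.
  apply: measurable_funM; last exact: measurable_snd.
  by apply: measurable_funD => //; exact: measurable_fst.
transitivity (\int[mu]_(s in `]0%R, +oo[)
   ((Gamma a)%:E * (s `^ (b - 1) * expR (- s))%:E))%E; last first.
  rewrite ge0_integralZl_EFin ?(ltW (Gamma_gt0 _))//.
  - by rewrite Gamma_integralE.
  - by move=> t _; rewrite lee_fin mulr_ge0 ?powR_ge0 ?expR_ge0.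
  - by apply/measurable_EFinP; exact: measurable_Gamma_integrand1.
apply: eq_integral => s; rewrite inE/= in_itv/= andbT => s0.
transitivity (\int[mu]_(r in `]0%R, +oo[) ((s `^ (a + b - 1) * expR (- s))%:E *
   (r `^ (a - 1) * expR (- (s * r)))%:E))%E.
  apply: eq_integral => r _; rewrite -EFinM; congr EFin.
  by rewrite mulrDl mul1r opprD expRD [r * s]mulrC; ring.
rewrite ge0_integralZl_EFin ?mulr_ge0 ?powR_ge0 ?expR_ge0//; last 2 first.
- by move=> r _; rewrite lee_fin mulr_ge0 ?powR_ge0 ?expR_ge0.
- by apply/measurable_EFinP; exact: measurable_Gamma_integrand.
rewrite Gamma_scale// -!EFinM; congr EFin.
have -> : a + b - 1 = a + (b - 1) by ring.
by rewrite powRDp// powRN; field; rewrite gt_eqF// powR_gt0.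
Qed.

(** The Beta integral at [(a, 1)] is both [1/a] and [Gamma(a) / Gamma(a+1)]. *)
Lemma GammaS (a : R) : 0 < a -> Gamma (a + 1) = a * Gamma a.
Proof.
move=> a0; have := beta_integral_1 a0; rewrite beta_integralE//.
rewrite Gamma_1 mulr1 => -[h].
have G1 : Gamma (a + 1) != 0 by rewrite gt_eqF// Gamma_gt0// addr_gt0.
have -> : Gamma a = Gamma (a + 1) / a.
  by rewrite -[LHS](divfK G1) h mulrC.
by field; rewrite gt_eqF.
Qed.

Lemma Gamma_addn (a : R) n : 0 < a ->
  Gamma (a + n%:R) = rising_fact a n * Gamma a.
Proof.
move=> a0; rewrite /rising_fact; elim: n => [|n ih].
  by rewrite big_ord0 addr0 mul1r.
rewrite big_ord_recr/= -addn1 natrD addrA GammaS; last exact: ltr_wpDr.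
by rewrite ih; ring.
Qed.

End Gamma.

(** * Termwise integration of real and complex series *)

Section RealSeries.
Context {d} {T : measurableType d} {R : realType}.
Variable mu : {measure set T -> \bar R}.

Definition abs_summable (u : nat -> R) : Prop :=
  (\sum_(k <oo) `|u k|%:E < +oo)%E.

Lemma nneseries_ge_term (v : nat -> \bar R) k : (forall j, (0 <= v j)%E) ->
  (v k <= \sum_(j <oo) v j)%E.
Proof.
move=> v0; apply: le_trans (nneseries_lim_ge k.+1 _) => //.
by rewrite big_nat_recr//= leeDr// sume_ge0.
Qed.

Lemma nneseries_lty_cvg (v : nat -> R) : (forall k, 0 <= v k) ->
  (\sum_(k <oo) (v k)%:E < +oo)%E ->
  cvgn (series v) /\ (\sum_(k <oo) (v k)%:E)%E = (limn (series v))%:E.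
Proof.
move=> v0 vy.
have nd : {homo series v : n m / (n <= m)%N >-> n <= m}.
  by apply/nondecreasing_seqP => n; rewrite /series/= big_nat_recr//= lerDl.
have cv : cvgn (series v).
  apply: nondecreasing_is_cvgn => //.
  exists (fine (\sum_(k <oo) (v k)%:E)%E) => _ [n _ <-].
  rewrite -lee_fin fineK; last first.
    by rewrite ge0_fin_numE//; apply: nneseries_ge0 => k _ _; rewrite lee_fin.
  by rewrite /series/= -sumEFin; apply: nneseries_lim_ge => k _ _; rewrite lee_fin.
split => //; rewrite -EFin_lim//; congr (limn _); apply/funext => n.
by rewrite /series/= sumEFin.
Qed.

Lemma abs_summable_cvg (u : nat -> R) : abs_summable u -> cvgn (series u).
Proof.
move=> /(nneseries_lty_cvg (fun k => normr_ge0 (u k)))[cu _].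
exact: normed_cvg.
Qed.

(** The partial sums are dominated by the sum of the absolute values, which is
    integrable by monotone convergence. *)
Lemma integral_series (D : set T) (u : nat -> T -> R) :
  measurable D ->
  (forall k, measurable_fun D (u k)) ->
  (forall t, D t -> abs_summable (u ^~ t)) ->
  (\sum_(k <oo) \int[mu]_(t in D) `|u k t|%:E < +oo)%E ->
  mu.-integrable D (fun t => (limn (series (u ^~ t)))%:E) /\
  series (fun k => \int[mu]_(t in D) u k t) @ \oo
    --> \int[mu]_(t in D) limn (series (u ^~ t)).
Proof.
move=> mD mu_ us uy.
pose f_ n t := (series (u ^~ t) n)%:E.
pose f t := (limn (series (u ^~ t)))%:E.
pose g t := (\sum_(k <oo) `|u k t|%:E)%E.
have mf k : measurable_fun D (fun t => `|u k t|%:E).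
  by apply/measurable_EFinP; exact: measurableT_comp.
have gE t : D t -> forall n, (`|f_ n t| <= g t)%E.
  move=> Dt n; apply: (@le_trans _ _ (\sum_(0 <= k < n) `|u k t|%:E)%E).
    by rewrite sumEFin lee_fin ler_norm_sum.
  by apply: nneseries_lim_ge => k _ _; rewrite lee_fin.
have mg : measurable_fun D g by apply: ge0_emeasurable_sum => // k t _ _; rewrite lee_fin.
have g0 t : (0 <= g t)%E by apply: nneseries_ge0 => k _ _; rewrite lee_fin.
have ig : mu.-integrable D g.
  apply/integrableP; split => //.
  under eq_integral do rewrite gee0_abs//.
  by rewrite integral_nneseries// => k t _; rewrite lee_fin.
have mf_ n : measurable_fun D (f_ n).
  by apply/measurable_EFinP; exact: measurable_sum.
have cf t : D t -> f_ ^~ t @ \oo --> f t.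
  move=> Dt; apply: cvg_EFin; first exact: nearW.
  exact: abs_summable_cvg (us t Dt).
have mfl : measurable_fun D f.
  by apply: (@emeasurable_fun_cvg _ _ _ D f_ f) => // t Dt; exact: cf.
have [iff _ cI] := dominated_convergence mD mf_ mfl
  (aeW mu cf) ig (aeW mu (fun t n Dt => gE t Dt n)).
split => //.
have iu k : mu.-integrable D (EFin \o u k).
  apply/integrableP; split; first exact/measurable_EFinP.
  apply: le_lt_trans uy.
  by apply: (nneseries_ge_term (v := fun k => \int[mu]_(t in D) `|u k t|%:E)%E) => i; exact: integral_ge0.
have fin : (\int[mu]_(t in D) f t)%E \is a fin_num by exact: integrable_fin_num.
move: cI; rewrite -(fineK fin) => /fine_cvgP[_]; apply: cvg_trans.
apply: near_eq_cvg; apply: nearW => n /=; rewrite /f_ /series/=.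
under eq_integral do rewrite -sumEFin.
rewrite (integral_sum mD iu) -[RHS]/(fine (\sum_(0 <= k < n) \int[mu]_(t in D) u k t)%:E).
rewrite -sumEFin; congr fine; apply: eq_bigr => k _.
by rewrite /Rintegral [RHS]fineK//; have H := integrable_fin_num mD (iu k); apply: H.
Qed.

End RealSeries.

Section ComplexSeries.
Context {R : realType}.
Implicit Types u : nat -> R[i].

Lemma cabs_ge0 (z : R[i]) : 0 <= cabs z.
Proof. by case: z => a b; rewrite /cabs/= sqrtr_ge0. Qed.

Lemma cabsM (z w : R[i]) : cabs (z * w) = cabs z * cabs w.
Proof. exact: ComplexField.Normc.normcM. Qed.

Lemma cabsV (z : R[i]) : cabs z^-1 = (cabs z)^-1.
Proof. exact: ComplexField.Normc.normcV. Qed.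

Lemma cabs_real (a : R) : 0 <= a -> cabs a%:C = a.
Proof. by move=> a0; rewrite /cabs/= expr0n/= addr0 sqrtr_sqr ger0_norm. Qed.

Lemma cabs1 : cabs 1 = 1 :> R.
Proof. exact: ComplexField.Normc.normc1. Qed.

Lemma cabsX (z : R[i]) n : cabs (z ^+ n) = cabs z ^+ n.
Proof.
elim: n => [|n ih]; first by rewrite !expr0 cabs1.
by rewrite !exprS cabsM ih.
Qed.

Lemma cabs_gt0 (z : R[i]) : z != 0 -> 0 < cabs z.
Proof.
move=> z0; rewrite lt_def cabs_ge0 andbT; apply: contra z0 => /eqP.
by move/ComplexField.Normc.eq0_normc => ->.
Qed.

Lemma Re_le_cabs (z : R[i]) : `|complex.Re z| <= cabs z.
Proof.
by case: z => a b; rewrite /cabs/= -sqrtr_sqr ler_wsqrtr// lerDl sqr_ge0.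
Qed.

Lemma Im_le_cabs (z : R[i]) : `|complex.Im z| <= cabs z.
Proof.
by case: z => a b; rewrite /cabs/= -sqrtr_sqr ler_wsqrtr// lerDr sqr_ge0.
Qed.

Lemma cabs_le (z : R[i]) : cabs z <= `|complex.Re z| + `|complex.Im z|.
Proof.
case: z => a b; rewrite /cabs/= -[leRHS]ger0_norm ?addr_ge0// -sqrtr_sqr.
rewrite ler_wsqrtr// sqrrD !real_normK ?num_real// addrAC lerDl.
by rewrite mulrn_wge0// mulr_ge0.
Qed.

Lemma normc_cabs (z : R[i]) : `|z| = (cabs z)%:C.
Proof. by rewrite normc_def; case: z. Qed.

Lemma cvg_complex (u : nat -> R[i]) (a b : R) :
  complex.Re (u n) @[n --> \oo] --> a ->
  complex.Im (u n) @[n --> \oo] --> b ->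
  (u : nat -> R[i]^o) @ \oo --> (a +i* b : R[i]^o).
Proof.
move=> /cvgrPdist_lt ua /cvgrPdist_lt ub; apply/cvgrPdist_lt => e.
rewrite ltcE /= => /andP[/eqP ie re].
have e2 : 0 < complex.Re e / 2 by rewrite divr_gt0.
near=> n.
rewrite normc_cabs ltcE /= ie eqxx /=.
apply: (le_lt_trans (cabs_le _)); rewrite [ltRHS](splitr (complex.Re e)).
have -> : complex.Re (a +i* b - u n) = a - complex.Re (u n) by case: (u n).
have -> : complex.Im (a +i* b - u n) = b - complex.Im (u n) by case: (u n).
rewrite ltrD//; near: n; [exact: ua|exact: ub].
Unshelve. all: by end_near.
Qed.

Lemma Re_sum (I : Type) (s : seq I) (F : I -> R[i]) :
  complex.Re (\sum_(i <- s) F i) = \sum_(i <- s) complex.Re (F i).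
Proof.
by elim/big_rec2: _ => //= i x y _ <-; case: (F i) => ? ?; case: y.
Qed.

Lemma Im_sum (I : Type) (s : seq I) (F : I -> R[i]) :
  complex.Im (\sum_(i <- s) F i) = \sum_(i <- s) complex.Im (F i).
Proof.
by elim/big_rec2: _ => //= i x y _ <-; case: (F i) => ? ?; case: y.
Qed.

Lemma cvg_cseries u (a b : R) :
  series (@complex.Re R \o u) @ \oo --> a ->
  series (@complex.Im R \o u) @ \oo --> b ->
  series (u : (R[i]^o)^nat) @ \oo --> (a +i* b : R[i]^o).
Proof.
move=> ua ub; apply: cvg_complex.
- by apply: cvg_trans ua; apply: near_eq_cvg; apply: nearW => n; rewrite /series/= Re_sum.
- by apply: cvg_trans ub; apply: near_eq_cvg; apply: nearW => n; rewrite /series/= Im_sum.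
Qed.

Lemma csum_lim u (l : R[i]) :
  series (u : (R[i]^o)^nat) @ \oo --> (l : R[i]^o) -> csum u = l.
Proof. by move=> ul; apply: (@cvg_lim (R[i]^o)) => //; exact: norm_hausdorff. Qed.

(** Absolute convergence, in a form that monotone convergence and comparison of
    nonnegative series apply to directly. *)
Definition csummable u : Prop := (\sum_(k <oo) (cabs (u k))%:E < +oo)%E.

Lemma csummable_Re u : csummable u -> abs_summable (@complex.Re R \o u).
Proof.
apply: le_lt_trans; apply: lee_nneseries => [k _ _|k _]; rewrite lee_fin//.
exact: Re_le_cabs.
Qed.

Lemma csummable_Im u : csummable u -> abs_summable (@complex.Im R \o u).
Proof.
apply: le_lt_trans; apply: lee_nneseries => [k _ _|k _]; rewrite lee_fin//.
exact: Im_le_cabs.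
Qed.

Lemma csumE u : csummable u -> csum u =
  limn (series (@complex.Re R \o u)) +i* limn (series (@complex.Im R \o u)).
Proof.
move=> su; apply: csum_lim; apply: cvg_cseries.
- exact: abs_summable_cvg (csummable_Re su).
- exact: abs_summable_cvg (csummable_Im su).
Qed.

Lemma csum_cvg u : csummable u ->
  series (u : (R[i]^o)^nat) @ \oo --> (csum u : R[i]^o).
Proof.
move=> su; rewrite csumE//; apply: cvg_cseries.
- exact: abs_summable_cvg (csummable_Re su).
- exact: abs_summable_cvg (csummable_Im su).
Qed.

Lemma csummableZ u (c : R[i]) : csummable u -> csummable (fun k => c * u k).
Proof.
move=> su; rewrite /csummable; under eq_eseriesr do rewrite cabsM EFinM.
rewrite nneseriesZl; last by move=> k _; rewrite lee_fin cabs_ge0.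
by rewrite lte_mul_pinfty// ?lee_fin ?cabs_ge0.
Qed.

Lemma csumZ u (c : R[i]) : csummable u ->
  csum (fun k => c * u k) = c * csum u.
Proof.
move=> su; apply: csum_lim.
have H := cvgZl_tmp (k := c) (csum_cvg su).
apply: (cvg_trans _ (H _)); apply: near_eq_cvg; apply: nearW => n.
by rewrite /series/= /GRing.scale/= mulr_sumr.
Qed.

Lemma csummableS u : csummable u <-> csummable (u \o S).
Proof.
rewrite /csummable nneseries_recl//; last by move=> k _; rewrite lee_fin cabs_ge0.
rewrite -nneseries_addn; last by move=> k; rewrite lee_fin cabs_ge0.
under eq_eseriesr do rewrite addn1.
split => [|h]; last by rewrite lte_add_pinfty ?ltry.
by apply: le_lt_trans; rewrite leeDr// lee_fin cabs_ge0.
Qed.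

Lemma csumS u : csummable u -> csum u = u 0 + csum (u \o S).
Proof.
move=> su; have /csum_cvg su' := (csummableS u).1 su.
have h : series (u : (R[i]^o)^nat) n.+1 @[n --> \oo] --> (u 0 + csum (u \o S) : R[i]^o).
  have H := cvgD (cvg_cst (u 0 : R[i]^o)) su'.
  apply: (cvg_trans _ (H _ _)); apply: near_eq_cvg; apply: nearW => n.
  by rewrite /series/= big_nat_recl//.
by apply: csum_lim; rewrite -cvg_shiftS.
Qed.

End ComplexSeries.

Section ComplexIntegral.
Context {R : realType}.
Local Notation mu := (@lebesgue_measure R).

Lemma measurable_cabs (D : set R) (h : R -> R[i]) :
  measurable_fun D (fun t => complex.Re (h t)) ->
  measurable_fun D (fun t => complex.Im (h t)) ->
  measurable_fun D (fun t => (cabs (h t))%:E).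
Proof.
move=> mRe mIm; apply/measurable_EFinP.
rewrite (_ : (fun t => _) = (fun t =>
  Num.sqrt ((complex.Re (h t)) ^+ 2 + (complex.Im (h t)) ^+ 2))); last first.
  by apply/funext => t; rewrite /cabs; case: (h t).
apply: (measurableT_comp (continuous_measurable_fun (@sqrt_continuous R))) => //.
by apply: measurable_funD; apply: measurable_funX.
Qed.

(** Both components are dominated by the modulus, so that the real theorem
    applies to each. *)
Lemma cintegral_series (D : set R) (F : nat -> R -> R[i]) : measurable D ->
  (forall k, measurable_fun D (fun t => complex.Re (F k t))) ->
  (forall k, measurable_fun D (fun t => complex.Im (F k t))) ->
  (forall t, D t -> csummable (F ^~ t)) ->
  (\sum_(k <oo) \int[mu]_(t in D) (cabs (F k t))%:E < +oo)%E ->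
  cintegrable D (fun t => csum (F ^~ t)) /\
  series ((fun k => cintegral D (F k)) : (R[i]^o)^nat) @ \oo -->
    (cintegral D (fun t => csum (F ^~ t)) : R[i]^o).
Proof.
move=> mD mRe mIm sF FL.
have mabs k : measurable_fun D (fun t => (cabs (F k t))%:E) by exact: measurable_cabs.
have le k (P : R[i] -> R) : (forall z, `|P z| <= cabs z) ->
    measurable_fun D (fun t => P (F k t)) ->
    (\int[mu]_(t in D) `|P (F k t)|%:E <= \int[mu]_(t in D) (cabs (F k t))%:E)%E.
  move=> PC mP; apply: ge0_le_integral => //.
  - by apply/measurable_EFinP; exact: measurableT_comp.
  - exact: mabs.
  - by move=> t _; rewrite lee_fin.
have H (P : R[i] -> R) : (forall z, `|P z| <= cabs z) ->
    (forall k, measurable_fun D (fun t => P (F k t))) ->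
    mu.-integrable D (fun t => (limn (series (fun k => P (F k t))))%:E) /\
    series (fun k => \int[mu]_(t in D) P (F k t)) @ \oo
      --> \int[mu]_(t in D) limn (series (fun k => P (F k t))).
  move=> PC mP; apply: (@integral_series _ (measurableTypeR R) R mu D (fun k t => P (F k t))) => //.
  - move=> t Dt; apply: le_lt_trans (sF t Dt).
    by apply: lee_nneseries => [k _ _|k _]; rewrite lee_fin.
  - apply: le_lt_trans FL; apply: lee_nneseries => [k _ _|k _]; last exact: le.
    by apply: integral_ge0 => t _; rewrite lee_fin.
have [iR cR] := H _ (@Re_le_cabs R) mRe.
have [iI cI] := H _ (@Im_le_cabs R) mIm.
split.
- split.
  + apply: eq_integrable iR => // t /[!inE] Dt.
    by rewrite csumE//; exact: sF.
  + apply: eq_integrable iI => // t /[!inE] Dt.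
    by rewrite csumE//; exact: sF.
- rewrite /cintegral.
  have -> : \int[mu]_(t in D) complex.Re (csum (F ^~ t)) =
      \int[mu]_(t in D) limn (series (fun k => complex.Re (F k t))).
    by apply: eq_Rintegral => t /[!inE] Dt; rewrite csumE//; exact: sF.
  have -> : \int[mu]_(t in D) complex.Im (csum (F ^~ t)) =
      \int[mu]_(t in D) limn (series (fun k => complex.Im (F k t))).
    by apply: eq_Rintegral => t /[!inE] Dt; rewrite csumE//; exact: sF.
  exact: cvg_cseries.
Qed.

End ComplexIntegral.

(** * The binomial series and Euler's integral for the Gauss function *)

Section BinomialSeries.
Context {R : realType}.
Local Notation mu := (@lebesgue_measure R).

(** The coefficient of [x^n] in [(1-x)^(-b)]. *)
Definition binomial_coef (b : R) (n : nat) : R := rising_fact b n / n`!%:R.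

Lemma rising_factS (b : R) n : rising_fact b n.+1 = rising_fact b n * (b + n%:R).
Proof. by rewrite /rising_fact big_ord_recr. Qed.

Lemma rising_fact_recl (b : R) n : rising_fact b n.+1 = b * rising_fact (b + 1) n.
Proof.
rewrite /rising_fact big_ord_recl addr0; congr (_ * _).
by apply: eq_bigr => i _; rewrite /bump/= natrD addrA.
Qed.

Lemma rising_fact_ge0 (b : R) n : 0 <= b -> 0 <= rising_fact b n.
Proof. by move=> b0; rewrite prodr_ge0// => i _; rewrite addr_ge0. Qed.

Lemma rising_fact_gt0 (b : R) n : 0 < b -> 0 < rising_fact b n.
Proof. by move=> b0; rewrite prodr_gt0// => i _; rewrite ltr_pwDl. Qed.

Lemma factr_gt0 n : 0 < n`!%:R :> R.
Proof. by rewrite ltr0n fact_gt0. Qed.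

Lemma binomial_coef_pascal (b : R) n :
  binomial_coef b n.+1 = binomial_coef (b + 1) n.+1 - binomial_coef (b + 1) n.
Proof.
rewrite /binomial_coef rising_fact_recl rising_factS factS natrM.
have n1 : n.+1%:R != 0 :> R by rewrite pnatr_eq0.
have f0 : n`!%:R != 0 :> R by rewrite gt_eqF// factr_gt0.
rewrite -addn1 natrD in n1 *.
by field; rewrite f0 n1.
Qed.

Lemma cvg_seriesZ (c l : R) (u v : nat -> R) : (forall n, v n = c * u n) ->
  series u @ \oo --> l -> series v @ \oo --> c * l.
Proof.
move=> uv ul; have H := cvgM (cvg_cst c) ul.
apply: (cvg_trans _ (H _ _)); apply: near_eq_cvg; apply: nearW => n.
transitivity (c * series u n); first by [].
by rewrite /series/= mulr_sumr; apply: eq_bigr => i _.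
Qed.

Lemma expR_nneseries (y : R) : 0 <= y ->
  (\sum_(n <oo) (y ^+ n / n`!%:R)%:E = (expR y)%:E)%E.
Proof.
move=> y0; rewrite /expR -EFin_lim; last exact: is_cvg_series_exp_coeff.
congr (limn _); apply/funext => n.
by rewrite /series/= sumEFin.
Qed.

(** [Gamma(b) (1-x)^(-b)] is the integral of [t^(b-1) exp(-t) exp(xt)]; expanding
    the last exponential gives a series of nonnegative Gamma integrals. *)
Lemma nneseries_binomial (b x : R) : 0 < b -> 0 <= x < 1 ->
  (\sum_(n <oo) (binomial_coef b n * x ^+ n)%:E = ((1 - x) `^ (- b))%:E)%E.
Proof.
move=> b0 /andP[x0 x1]; have G0 := Gamma_gt0 b0.
have c0 n : 0 <= binomial_coef b n * x ^+ n.
  by rewrite mulr_ge0 ?exprn_ge0// divr_ge0 ?rising_fact_ge0 ?ltW.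
have -> : (1 - x) `^ (- b) = Gamma b * (1 - x) `^ (- b) / Gamma b.
  by rewrite mulrAC mulfV ?mul1r// gt_eqF.
apply: mule_solve => //.
rewrite -nneseriesZl; last by move=> n _; rewrite lee_fin.
rewrite -Gamma_scale ?subr_gt0//.
pose f n (t : R) := (x ^+ n / n`!%:R * (t `^ (b + n%:R - 1) * expR (- t)))%:E.
have cn0 n : 0 <= x ^+ n / n`!%:R by rewrite divr_ge0 ?exprn_ge0.
transitivity (\int[mu]_(t in `]0%R, +oo[) \sum_(n <oo) f n t)%E; last first.
  apply: eq_integral => t; rewrite inE/= in_itv/= andbT => t0.
  transitivity (\sum_(n <oo) (t `^ (b - 1) * expR (- t))%:E *
      ((x * t) ^+ n / n`!%:R)%:E)%E.
    apply: eq_eseriesr => n _; rewrite /f -EFinM; congr EFin.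
    have -> : b + n%:R - 1 = b - 1 + n%:R by ring.
    by rewrite powRDp// powR_mulrn ?ltW// exprMn; ring.
  rewrite nneseriesZl; last first.
    by move=> n _; rewrite lee_fin divr_ge0// exprn_ge0// mulr_ge0// ltW.
  rewrite expR_nneseries; last by rewrite mulr_ge0// ltW.
  rewrite -EFinM -mulrA -expRD; congr (_ * expR _)%:E; ring.
rewrite integral_nneseries//; last 2 first.
- move=> n; apply/measurable_EFinP; apply: measurable_funM => //.
  exact: measurable_Gamma_integrand1.
- by move=> n t _; rewrite lee_fin mulr_ge0// mulr_ge0 ?powR_ge0 ?expR_ge0.
apply: eq_eseriesr => n _; rewrite /f.
under [RHS]eq_integral do rewrite EFinM.
rewrite ge0_integralZl_EFin//; last 2 first.
- by move=> t _; rewrite lee_fin mulr_ge0 ?powR_ge0 ?expR_ge0.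
- by apply/measurable_EFinP; exact: measurable_Gamma_integrand1.
rewrite Gamma_integralE; last exact: ltr_wpDr.
rewrite Gamma_addn// -!EFinM; congr EFin.
by rewrite /binomial_coef; ring.
Qed.

Lemma norm_binomial_coef_le (b : R) n :
  `|binomial_coef b n| <= binomial_coef (`|b| + 1) n.
Proof.
rewrite /binomial_coef normrM normfV (ger0_norm (ler0n _ _)).
rewrite ler_wpM2r ?invr_ge0// /rising_fact normr_prod ler_prod// => i _.
rewrite normr_ge0/= (le_trans (ler_normD _ _))// (ger0_norm (ler0n _ _)).
by rewrite lerD2r lerDl.
Qed.

(** The coefficients for [b] are dominated by those for [|b| + 1], a positive
    exponent. *)
Lemma binomial_abs_summable (b x : R) : 0 <= x < 1 ->
  abs_summable (fun n => binomial_coef b n * x ^+ n).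
Proof.
move=> x01; have b1 : 0 < `|b| + 1 by rewrite ltr_wpDl.
rewrite /abs_summable; apply: (@le_lt_trans _ _ ((1 - x) `^ (- (`|b| + 1)))%:E); last exact: ltry.
rewrite -nneseries_binomial//; apply: lee_nneseries => [n _ _|n _]; first by rewrite lee_fin.
rewrite lee_fin normrM [X in _ * X]ger0_norm ?exprn_ge0//; last by case/andP: x01.
by rewrite ler_wpM2r ?exprn_ge0 ?norm_binomial_coef_le//; case/andP: x01.
Qed.

Lemma cvg_binomial_pos (b x : R) : 0 < b -> 0 <= x < 1 ->
  series (fun n => binomial_coef b n * x ^+ n) @ \oo --> (1 - x) `^ (- b).
Proof.
move=> b0 x01; have := nneseries_binomial b0 x01.
have c0 n : 0 <= binomial_coef b n * x ^+ n.
  case/andP : x01 => x0 x1.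
  by rewrite mulr_ge0 ?exprn_ge0// divr_ge0 ?rising_fact_ge0 ?ltW.
move=> H; have [] := nneseries_lty_cvg c0; first by rewrite H ltry.
by rewrite H => cv [->].
Qed.

(** By Pascal's rule the series for [b] is [1 - x] times the one for [b + 1].
    The range [b > -1] is reached because the exponent in the Bessel kernel,
    [alpha + (nu - 1)/2], may be negative. *)
Lemma cvg_binomial (b x : R) : -1 < b -> 0 <= x < 1 ->
  series (fun n => binomial_coef b n * x ^+ n) @ \oo --> (1 - x) `^ (- b).
Proof.
move=> b1 x01; have b10 : 0 < b + 1 by rewrite -ltrBlDr sub0r.
have x1 : 0 < 1 - x by case/andP: x01; rewrite subr_gt0.
have H := cvg_binomial_pos b10 x01.
set S := series _ in H.
have HS : S n.+1 @[n --> \oo] --> (1 - x) `^ (- (b + 1)) by rewrite cvg_shiftS.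
have -> : (1 - x) `^ (- b) =
    (1 - x) `^ (- (b + 1)) - x * (1 - x) `^ (- (b + 1)).
  have -> : - b = 1 + - (b + 1) by ring.
  by rewrite powRDp// powRr1 ?ltW//; ring.
rewrite -cvg_shiftS.
have := cvgB HS (cvgM (cvg_cst x) H).
move=> {}H; apply: (cvg_trans _ (H _ _ _)); apply: near_eq_cvg; apply: nearW => n.
transitivity (S n.+1 - x * S n); first by [].
rewrite /S /series/=; elim: n => [|n ih].
  by rewrite !big_nat1 big_geq// mulr0 subr0 /binomial_coef /rising_fact !big_ord0.
rewrite big_nat_recr//= [in RHS]big_nat_recr//= -ih.
by rewrite [X in _ - x * X = _]big_nat_recr//= (binomial_coef_pascal b) exprS; ring.
Qed.

Lemma measurable_powR_onem (q : R) (D : set R) :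
  measurable_fun D (fun t : R => (1 - t) `^ q).
Proof.
apply: measurable_funTS; apply: (measurableT_comp (measurable_powR _)) => //.
exact: measurable_funB.
Qed.

Lemma beta_integrable (a b : R) : 0 < a -> 0 < b ->
  mu.-integrable `]0, 1[ (fun t => (t `^ (a - 1) * (1 - t) `^ (b - 1))%:E).
Proof.
move=> a0 b0; apply/integrableP; split.
  apply/measurable_EFinP; apply: measurable_funM; last exact: measurable_powR_onem.
  by apply: measurable_funTS; exact: measurable_powR.
under eq_integral do rewrite gee0_abs ?lee_fin ?mulr_ge0 ?powR_ge0//.
by have := beta_integralE a0 b0; rewrite /beta_integral => ->; rewrite ltry.
Qed.

Lemma beta_RintegralE (a b : R) : 0 < a -> 0 < b ->
  \int[mu]_(t in `]0, 1[) (t `^ (a - 1) * (1 - t) `^ (b - 1))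
  = Gamma a * Gamma b / Gamma (a + b).
Proof.
by move=> a0 b0; rewrite /Rintegral; have := beta_integralE a0 b0; rewrite /beta_integral => ->.
Qed.

(** Expanding [(1 - zt)^(-b)] and integrating term by term leaves Beta integrals
    at [(a + n, c - a)], whose ratios to the first one are quotients of rising
    factorials, the coefficients of the Gauss series. *)
Lemma euler_integral (a b c z : R) : 0 < a < c -> -1 < b -> 0 <= z < 1 ->
  let w (t : R) := t `^ (a - 1) * (1 - t) `^ (c - a - 1) * (1 - z * t) `^ (- b) in
  mu.-integrable `]0, 1[ (fun t => (w t)%:E) /\
  \int[mu]_(t in `]0, 1[) w t
    = Gamma a * Gamma (c - a) / Gamma c * hyp2F1 b a c z.
Proof.
move=> /andP[a0 ac] b1 /[dup] z01 /andP[z0 z1] w.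
have c0 : 0 < c := lt_trans a0 ac.
have ca0 : 0 < c - a by rewrite subr_gt0.
pose v n (t : R) := t `^ (a + n%:R - 1) * (1 - t) `^ (c - a - 1).
pose k n := binomial_coef b n * z ^+ n.
pose u n (t : R) := k n * v n t.
have an n : 0 < a + n%:R by exact: ltr_wpDr.
have iv n : mu.-integrable `]0, 1[ (fun t => (v n t)%:E) by exact: beta_integrable.
have v0 n t : 0 <= v n t by rewrite mulr_ge0 ?powR_ge0.
have mv n : measurable_fun (`]0, 1[%classic : set R) (v n).
  by have /measurable_int /measurable_EFinP := iv n.
have vE n t : 0 < t -> v n t = t `^ (a - 1) * (1 - t) `^ (c - a - 1) * t ^+ n.
  move=> t0; rewrite /v; have -> : a + n%:R - 1 = a - 1 + n%:R by ring.
  by rewrite powRDp// powR_mulrn ?ltW//; ring.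
have uE t n : 0 < t -> u n t =
    t `^ (a - 1) * (1 - t) `^ (c - a - 1) * (binomial_coef b n * (z * t) ^+ n).
  by move=> t0; rewrite /u /k vE// exprMn; ring.
have zt t : 0 < t < 1 -> 0 <= z * t < 1.
  move=> /andP[t0 t1]; rewrite mulr_ge0 ?(ltW t0)//=.
  by apply: le_lt_trans z1; rewrite ler_piMr// ltW.
have su t : 0 < t < 1 -> abs_summable (u ^~ t).
  move=> t01; have /andP[t0 t1] := t01; rewrite /abs_summable.
  under eq_eseriesr do rewrite uE// normrM EFinM.
  rewrite nneseriesZl; last by move=> n _; rewrite lee_fin.
  by rewrite lte_mul_pinfty// ?lee_fin//; exact: binomial_abs_summable (zt _ t01).
have limu t : 0 < t < 1 -> limn (series (u ^~ t)) = w t.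
  move=> t01; have /andP[t0 t1] := t01.
  apply: cvg_lim => //.
  by apply: cvg_seriesZ (cvg_binomial b1 (zt _ t01)) => n; exact: uE.
have mu_ n : measurable_fun (`]0, 1[%classic : set R) (u n) by exact: measurable_funM.
have sI : (\sum_(n <oo) \int[mu]_(t in `]0%R, 1%R[) `|u n t|%:E < +oo)%E.
  apply: (@le_lt_trans _ _ (\sum_(n <oo) (Gamma a * Gamma (c - a) / Gamma (a + (c - a)))%:E * `|k n|%:E)%E).
    apply: lee_nneseries => [n _ _|n _].
      by apply: integral_ge0 => t _; rewrite lee_fin.
    rewrite muleC -beta_integralE// /beta_integral -ge0_integralZl_EFin//; last 2 first.
    - by move=> t _; rewrite lee_fin mulr_ge0 ?powR_ge0.
    - by apply/measurable_EFinP; have /measurable_int /measurable_EFinP := beta_integrable a0 ca0.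
    apply: ge0_le_integral => //.
    - by apply/measurable_EFinP; exact: (measurableT_comp (@normr_measurable R setT) (mu_ n)).
    - apply/measurable_EFinP; apply: measurable_funM => //.
      by have /measurable_int /measurable_EFinP := beta_integrable a0 ca0.
    - move=> t; rewrite /= in_itv/= => /andP[t0 t1].
      rewrite lee_fin /u normrM ler_wpM2l// ger0_norm// vE//.
      by rewrite ler_piMr ?mulr_ge0 ?powR_ge0// exprn_ile1// ltW.
  rewrite nneseriesZl; last by move=> n _; rewrite lee_fin.
  rewrite lte_mul_pinfty// ?lee_fin//; last exact: binomial_abs_summable z01.
  by rewrite divr_ge0 ?mulr_ge0 ?ltW ?Gamma_gt0// addr_gt0.
have [iw cw] := @integral_series _ (measurableTypeR R) R mu `]0, 1[ u
  (measurable_itv _) mu_ (fun t (h : `]0, 1[%classic t) => su t h) sI.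
split.
  apply: eq_integrable iw => // t; rewrite inE/= in_itv/= => t01.
  by rewrite limu.
pose K := Gamma a * Gamma (c - a) / Gamma c.
have K0 : K != 0 by rewrite gt_eqF// divr_gt0 ?mulr_gt0 ?Gamma_gt0.
have -> : \int[mu]_(t in `]0, 1[) w t = \int[mu]_(t in `]0, 1[) limn (series (u ^~ t)).
  by apply: eq_Rintegral => t; rewrite inE/= in_itv/= => t01; rewrite limu.
set I := (X in X = _) in cw *.
rewrite -/K; have -> : hyp2F1 b a c z = K^-1 * I; last by rewrite mulVKf.
apply: cvg_lim => //.
apply: cvg_seriesZ cw => i.
have vI : \int[mu]_(t in `]0, 1[) v i t =
    Gamma (a + i%:R) * Gamma (c - a) / Gamma (a + i%:R + (c - a)).
  exact: beta_RintegralE.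
have -> : \int[mu]_(t in `]0, 1[) u i t = k i * \int[mu]_(t in `]0, 1[) v i t.
  by apply: RintegralZl => //; exact: iv.
rewrite vI.
have -> : a + i%:R + (c - a) = c + i%:R by ring.
rewrite !Gamma_addn// /k /binomial_coef /K.
field.
by rewrite !gt_eqF ?Gamma_gt0 ?rising_fact_gt0 ?factr_gt0.
Qed.

End BinomialSeries.

(** * Composition of nonnegative kernels *)

Section Kernels.
Context {R : realType}.
Local Notation mu := (@lebesgue_measure R).
Local Open Scope ereal_scope.
Implicit Types (k l m n u v : R * R -> \bar R) (h : R -> \bar R).

(** With nonnegative kernels valued in the extended reals, composition needs no
    integrability: it is always defined, and associative by Tonelli. *)
Definition ge0_kernel k : Prop := measurable_fun setT k /\ forall z, 0 <= k z.

Definition kernel_int k h (x : R) : \bar R := \int[mu]_y (k (x, y) * h y).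

Definition kernel_comp k l (z : R * R) : \bar R :=
  kernel_int k (fun s => l (s, z.2)) z.1.

Lemma ge0_kernel_left k x : ge0_kernel k -> measurable_fun setT (fun y => k (x, y)).
Proof.
by case=> mk _; apply: (measurableT_comp mk); exact: measurable_fun_pair.
Qed.

Lemma ge0_kernel_right k y : ge0_kernel k -> measurable_fun setT (fun x => k (x, y)).
Proof.
by case=> mk _; apply: (measurableT_comp mk); exact: measurable_fun_pair.
Qed.

Lemma kernel_int_ge0 k h x : ge0_kernel k -> (forall y, 0 <= h y) ->
  0 <= kernel_int k h x.
Proof. by case=> _ k0 h0; apply: integral_ge0 => y _; rewrite mule_ge0. Qed.

Lemma measurable_kernel_int k h : ge0_kernel k ->
  measurable_fun setT h -> (forall y, 0 <= h y) ->
  measurable_fun setT (kernel_int k h).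
Proof.
move=> [mk k0] mh h0.
apply: (@measurable_fun_fubini_tonelli_F _ _ (measurableTypeR R)
  (measurableTypeR R) R mu (fun z => k z * h z.2)).
- apply: emeasurable_funM => //.
  exact: (measurableT_comp mh).
- by move=> z; rewrite mule_ge0.
Qed.

Lemma ge0_kernel_comp k l : ge0_kernel k -> ge0_kernel l ->
  ge0_kernel (kernel_comp k l).
Proof.
move=> [mk k0] [ml l0]; split; last first.
  by move=> z; apply: kernel_int_ge0.
apply: (@measurable_fun_fubini_tonelli_F _ _ (measurableTypeR R * measurableTypeR R)%type
  (measurableTypeR R) R mu (fun t => k (t.1.1, t.2) * l (t.2, t.1.2))).
- apply: emeasurable_funM.
  + apply: (measurableT_comp mk); apply: measurable_fun_pair => //.
    exact: (measurableT_comp measurable_fst).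
  + apply: (measurableT_comp ml); apply: measurable_fun_pair => //.
    exact: (measurableT_comp measurable_snd).
- by move=> t; rewrite mule_ge0.
Qed.

Lemma kernel_int_comp k l h x : ge0_kernel k -> ge0_kernel l ->
  measurable_fun setT h -> (forall y, 0 <= h y) ->
  kernel_int k (kernel_int l h) x = kernel_int (kernel_comp k l) h x.
Proof.
move=> kk kl mh h0.
have mlh s : measurable_fun setT (fun y => l (s, y) * h y).
  by apply: emeasurable_funM => //; exact: ge0_kernel_left.
rewrite /kernel_int.
transitivity (\int[mu]_s \int[mu]_y (k (x, s) * (l (s, y) * h y))).
  apply: eq_integral => s _; rewrite ge0_integralZl//.
  - exact: mlh.
  - by move=> y _; rewrite mule_ge0//; case: kl.
  - by case: kk.
rewrite (@fubini_tonelli _ _ (measurableTypeR R) (measurableTypeR R) R mu mu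
  (fun z => k (x, z.1) * (l z * h z.2))); last 2 first.
- apply: emeasurable_funM.
    exact: (measurableT_comp (ge0_kernel_left x kk)).
  apply: emeasurable_funM; first by case: kl.
  exact: (measurableT_comp mh).
- by move=> z; rewrite !mule_ge0//; [case: kk|case: kl].
apply: eq_integral => y _; rewrite -ge0_integralZr//.
- by apply: eq_integral => s _; rewrite muleA.
- apply: emeasurable_funM; first exact: ge0_kernel_left.
  exact: ge0_kernel_right.
- by move=> s _; rewrite mule_ge0//; [case: kk|case: kl].
Qed.

Lemma kernel_compA k l m : ge0_kernel k -> ge0_kernel l -> ge0_kernel m ->
  kernel_comp k (kernel_comp l m) = kernel_comp (kernel_comp k l) m.
Proof.
move=> kk kl km; apply/funext => z; rewrite /kernel_comp.
rewrite -kernel_int_comp//; first exact: ge0_kernel_right.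
by case: km.
Qed.

Definition kernel_scale (c : R) k (z : R * R) : \bar R := c%:E * k z.

Lemma ge0_kernel_scale c k : (0 <= c)%R -> ge0_kernel k -> ge0_kernel (kernel_scale c k).
Proof.
move=> c0 [mk k0]; split; last by move=> z; rewrite mule_ge0.
exact: emeasurable_funM.
Qed.

Lemma kernel_comp_scalel c k l : (0 <= c)%R -> ge0_kernel k -> ge0_kernel l ->
  kernel_comp (kernel_scale c k) l = kernel_scale c (kernel_comp k l).
Proof.
move=> c0 kk kl; apply/funext => z; rewrite /kernel_comp /kernel_int /kernel_scale.
rewrite -ge0_integralZl_EFin//.
- by apply: eq_integral => s _; rewrite muleA.
- by move=> s _; rewrite mule_ge0//; [case: kk|case: kl].
- by apply: emeasurable_funM; [exact: ge0_kernel_left|exact: ge0_kernel_right].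
Qed.

Lemma kernel_comp_scaler c k l : (0 <= c)%R -> ge0_kernel k -> ge0_kernel l ->
  kernel_comp k (kernel_scale c l) = kernel_scale c (kernel_comp k l).
Proof.
move=> c0 kk kl; apply/funext => z; rewrite /kernel_comp /kernel_int /kernel_scale.
rewrite -ge0_integralZl_EFin//.
- by apply: eq_integral => s _; rewrite muleCA.
- by move=> s _; rewrite mule_ge0//; [case: kk|case: kl].
- by apply: emeasurable_funM; [exact: ge0_kernel_left|exact: ge0_kernel_right].
Qed.

Lemma kernel_scaleE c k z : kernel_scale c k z = c%:E * k z.
Proof. by []. Qed.

Lemma kernel_compE k l x y :
  kernel_comp k l (x, y) = \int[mu]_s (k (x, s) * l (s, y)).
Proof. by []. Qed.

Lemma kernel_scaleA c d k : kernel_scale c (kernel_scale d k) = kernel_scale (c * d) k.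
Proof. by apply/funext => z; rewrite /kernel_scale muleA EFinM. Qed.

(** Bracketing that brings the two middle factors together. *)
Lemma kernel_comp_four c d k1 k2 k3 k4 : (0 <= c)%R -> (0 <= d)%R ->
  ge0_kernel k1 -> ge0_kernel k2 -> ge0_kernel k3 -> ge0_kernel k4 ->
  kernel_comp (kernel_scale c (kernel_comp k1 k2))
              (kernel_scale d (kernel_comp k3 k4)) =
  kernel_scale (c * d) (kernel_comp (kernel_comp k1 (kernel_comp k2 k3)) k4).
Proof.
move=> c0 d0 g1 g2 g3 g4.
have g12 := ge0_kernel_comp g1 g2; have g34 := ge0_kernel_comp g3 g4.
have g23 := ge0_kernel_comp g2 g3.
rewrite (kernel_comp_scalel c0 g12 (ge0_kernel_scale d0 g34)).
rewrite (kernel_comp_scaler d0 g12 g34) kernel_scaleA.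
by rewrite (kernel_compA g12 g3 g4) -(kernel_compA g1 g2 g3).
Qed.

(** Bracketing used once the middle factors have been exchanged: each of them
    then meets the outer factor that it can be composed with. *)
Lemma kernel_comp_regroup e k l m n u v : (0 <= e)%R ->
  ge0_kernel k -> ge0_kernel l -> ge0_kernel m -> ge0_kernel n ->
  ge0_kernel u -> ge0_kernel v ->
  kernel_comp k l = kernel_scale e u -> kernel_comp m n = kernel_scale e v ->
  kernel_comp (kernel_comp k (kernel_comp l m)) n =
  kernel_scale (e * e) (kernel_comp u v).
Proof.
move=> e0 gk gl gm gn gu gv kl mn.
rewrite (kernel_compA gk gl gm) kl.
rewrite -(kernel_compA (ge0_kernel_scale e0 gu) gm gn) mn.
rewrite (kernel_comp_scalel e0 gu (ge0_kernel_scale e0 gv)).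
by rewrite (kernel_comp_scaler e0 gu gv) kernel_scaleA.
Qed.

End Kernels.

(** * Weyl fractional integrals in the square of the variable *)

Section WeylKernels.
Context {R : realType}.
Local Notation mu := (@lebesgue_measure R).

(** Up to a constant, the kernel of the Weyl fractional integral of order [a] in
    the square of the variable, preceded by a multiplication by [y^(q-1)].  It
    is extended by zero so that compositions are integrals over the line. *)
Definition weyl_kernel (a q : R) (z : R * R) : \bar R :=
  (if (0 < z.1) && (z.1 < z.2) then
    (z.2 ^+ 2 - z.1 ^+ 2) `^ (a - 1) * z.2 `^ q else 0)%:E.

Lemma ge0_weyl_kernel a q : ge0_kernel (weyl_kernel a q).
Proof.
split; last by move=> z; rewrite lee_fin; case: ifP => // _; rewrite mulr_ge0 ?powR_ge0.
apply/measurable_EFinP; apply: measurable_fun_ifT => //.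
- apply: measurable_and.
  + exact: measurable_fun_ltr.
  + exact: measurable_fun_ltr.
- apply: measurable_funM.
  + apply: (measurableT_comp (measurable_powR _)).
    by apply: measurable_funB; apply: measurable_funX.
  + exact: (measurableT_comp (measurable_powR _)).
Qed.

Lemma weyl_kernelE a q x y : 0 < x < y ->
  weyl_kernel a q (x, y) = ((y ^+ 2 - x ^+ 2) `^ (a - 1) * y `^ q)%:E.
Proof. by move=> xy; rewrite /weyl_kernel/= xy. Qed.

Lemma weyl_kernel_eq0 a q x y : ~~ (0 < x < y) -> weyl_kernel a q (x, y) = 0%E.
Proof. by move=> xy; rewrite /weyl_kernel/= (negbTE xy). Qed.

Definition weyl_integral (a p b x y : R) : \bar R :=
  (\int[mu]_(s in `]x, y[)
    ((s ^+ 2 - x ^+ 2) `^ (a - 1) * s `^ p * (y ^+ 2 - s ^+ 2) `^ (b - 1))%:E)%E.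

Lemma weyl_compE a p b q x y : 0 < x < y ->
  kernel_comp (weyl_kernel a p) (weyl_kernel b q) (x, y) =
  ((y `^ q)%:E * weyl_integral a p b x y)%E.
Proof.
move=> /andP[x0 xy]; rewrite /kernel_comp /kernel_int /= /weyl_integral.
rewrite -ge0_integralZl_EFin ?powR_ge0//; last 2 first.
- by move=> s _; rewrite lee_fin !mulr_ge0 ?powR_ge0.
- apply/measurable_EFinP; apply: measurable_funTS; apply: measurable_funM.
    apply: measurable_funM; last exact: measurable_powR.
    apply: (measurableT_comp (measurable_powR _)) => //.
    by apply: measurable_funB => //; exact: measurable_funX.
  apply: (measurableT_comp (measurable_powR _)) => //.
  by apply: measurable_funB => //; exact: measurable_funX.
rewrite [RHS]integral_mkcond; apply: eq_integral => s _; rewrite patchE.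
rewrite mem_setE in_itv/=; case: ifPn => [/andP[xs sy]|].
  rewrite !weyl_kernelE ?xs ?x0// ?sy ?(lt_trans x0 xs)//.
  by rewrite -!EFinM; congr EFin; ring.
rewrite negb_and => /orP[xs|sy].
  by rewrite weyl_kernel_eq0 ?mul0e// x0.
by rewrite [X in (_ * X)%E]weyl_kernel_eq0 ?mule0// negb_and sy orbT.
Qed.

Lemma weyl_comp_eq0 a p b q x y : ~~ (0 < x < y) ->
  kernel_comp (weyl_kernel a p) (weyl_kernel b q) (x, y) = 0%E.
Proof.
move=> xy; apply: integral0_eq => s _ /=.
have [/andP[x0 xs]|xs] := boolP (0 < x < s); last by rewrite weyl_kernel_eq0 ?mul0e.
rewrite [X in (_ * X)%E]weyl_kernel_eq0 ?mule0//.
by apply: contra xy => /andP[s0 sy]; rewrite x0 (lt_trans xs sy).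
Qed.

Lemma powR_div (x y p : R) : 0 <= x -> 0 < y -> (x / y) `^ p = x `^ p / y `^ p.
Proof.
move=> x0 y0; rewrite powRM// ?invr_ge0 ?(ltW y0)//.
by rewrite -[y^-1]powR_inv1 ?(ltW y0)// -powRrM mulN1r powRN.
Qed.

Lemma powR_sqr (x p : R) : 0 <= x -> (x ^+ 2) `^ p = x `^ (2 * p).
Proof. by move=> x0; rewrite -powR_mulrn// -powRrM. Qed.

Lemma powR_mulr (x p : R) : 0 < x -> x `^ p * x = x `^ (p + 1).
Proof. by move=> x0; rewrite powRDp// powRr1// ltW. Qed.

Lemma sqr_lt (x y : R) : 0 < x -> x < y -> x ^+ 2 < y ^+ 2.
Proof. by move=> x0 xy; rewrite ltr_pXn2r// nnegrE ltW// (lt_trans x0). Qed.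

Lemma continuous_sqr_sub (c : R) (s : R) : {for s, continuous (fun t : R => t ^+ 2 - c)}.
Proof. by apply: cvgB; [exact: exprn_continuous|exact: cvg_cst]. Qed.

Lemma is_derive_sqr_sub (c d s : R) :
  is_derive s 1 (fun t : R => (t ^+ 2 - c) / d) (2 * s / d).
Proof.
by apply: is_derive_eq; rewrite /GRing.scale/=; ring.
Qed.

Lemma measurable_weyl_integrand (a p b x y : R) (D : set R) :
  measurable_fun D (fun s : R =>
    (s ^+ 2 - x ^+ 2) `^ (a - 1) * s `^ p * (y ^+ 2 - s ^+ 2) `^ (b - 1)).
Proof.
apply: measurable_funTS; apply: measurable_funM.
  apply: measurable_funM; last exact: measurable_powR.
  apply: (measurableT_comp (measurable_powR _)) => //.
  by apply: measurable_funB => //; exact: measurable_funX.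
apply: (measurableT_comp (measurable_powR _)) => //.
by apply: measurable_funB => //; exact: measurable_funX.
Qed.

(** The exponent [1] of [s] makes [2 s ds] the differential of [s^2], so that the
    substitution [t = (s^2 - x^2) / (y^2 - x^2)] leaves a Beta integral. *)
Lemma weyl_integral_beta (a b x y : R) : 0 < a -> 0 < b -> 0 < x < y ->
  weyl_integral a 1 b x y =
  (Gamma a * Gamma b / Gamma (a + b) / 2 * (y ^+ 2 - x ^+ 2) `^ (a + b - 1))%:E.
Proof.
move=> a0 b0 /andP[x0 xy]; have y0 := lt_trans x0 xy.
set D := y ^+ 2 - x ^+ 2.
have D0 : 0 < D by rewrite subr_gt0 sqr_lt.
have Dn : D != 0 by rewrite gt_eqF.
have Dp q : D `^ q != 0 by rewrite gt_eqF// powR_gt0.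
have -> : Gamma a * Gamma b / Gamma (a + b) / 2 * D `^ (a + b - 1) =
   Gamma a * Gamma b / Gamma (a + b) / (2 / D `^ (a + b - 1)).
  by field; rewrite Dp gt_eqF// Gamma_gt0// addr_gt0.
apply: mule_solve; first by rewrite divr_gt0 ?powR_gt0.
rewrite -beta_integralE// /weyl_integral -ge0_integralZl_EFin; last 4 first.
- by [].
- by move=> s _; rewrite lee_fin !mulr_ge0 ?powR_ge0.
- by apply/measurable_EFinP; exact: measurable_weyl_integrand.
- by rewrite divr_ge0 ?powR_ge0.
have [u [v ex]] := itvoo_exhaustion xy.
pose F (s : R) := (s ^+ 2 - x ^+ 2) / D.
have E : F @` (`]x, y[%classic : set R) = `]0, 1[%classic.
  apply/seteqP; split => [_ [s /= sI <-]|t /=]; last rewrite in_itv/= => /andP[t0 t1].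
    move: sI; rewrite !in_itv/= => /andP[xs sy].
    have s0 := lt_trans x0 xs.
    by rewrite divr_gt0 ?subr_gt0 ?sqr_lt//= ltr_pdivrMr// mul1r ltrD2r sqr_lt.
  have tD : 0 < t * D by rewrite mulr_gt0.
  have xtD : 0 < x ^+ 2 + t * D by rewrite addr_gt0// exprn_gt0.
  exists (Num.sqrt (x ^+ 2 + t * D)); last first.
    by rewrite /F sqr_sqrtr ?ltW// addrAC subrr add0r mulfK.
  rewrite /= in_itv/=; apply/andP; split.
  - by rewrite -[ltLHS]gtr0_norm// -sqrtr_sqr ltr_sqrt// ltrDl.
  - rewrite -[ltRHS]gtr0_norm// -sqrtr_sqr ltr_sqrt ?exprn_gt0//.
    by rewrite -ltrBrDl -/D gtr_pMl.
have oI : open (`]x, y[%classic : set R) by exact: interval_open.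
have dd (s : R) : `]x, y[%classic s -> is_derive s 1 F (2 * s / D).
  by move=> _; exact: is_derive_sqr_sub.
rewrite /beta_integral -E (ge0_substitution_incr ex oI dd
  (G := fun t => t `^ (a - 1) * (1 - t) `^ (b - 1))) ?E; last 6 first.
- move=> s _; apply: cvgM; last exact: cvg_cst.
  by apply: cvgM; [exact: cvg_cst|exact: cvg_id].
- move=> s; rewrite /= in_itv/= => /andP[xs _].
  by rewrite divr_ge0 ?mulr_ge0 ?ltW// (lt_trans x0 xs).
- move=> s t; rewrite /= !in_itv/= => /andP[xs _] _ st.
  by rewrite ltr_pM2r ?invr_gt0// ltrD2r sqr_lt// (lt_trans x0 xs).
- exact: interval_open.
- move=> t; rewrite /= in_itv/= => /andP[t0 t1]; apply: cvgM.
    exact: powR_continuous_at.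
  apply: (@continuous_comp _ _ _ (fun r : R => 1 - r) (powR (R := R) ^~ (b - 1))).
    by apply: cvgB; [exact: cvg_cst|exact: cvg_id].
  by apply: powR_continuous_at; rewrite subr_gt0.
- by move=> t _; rewrite mulr_ge0 ?powR_ge0.
apply: eq_integral => s; rewrite inE/= in_itv/= => /andP[xs sy].
have s0 := lt_trans x0 xs.
have C0 : 0 < s ^+ 2 - x ^+ 2 by rewrite subr_gt0 sqr_lt.
have A0 : 0 < y ^+ 2 - s ^+ 2 by rewrite subr_gt0 sqr_lt.
rewrite -EFinM; congr EFin.
have -> : 1 - F s = (y ^+ 2 - s ^+ 2) / D by rewrite /F /D; field.
rewrite /F !powR_div ?ltW// powRr1 ?ltW//.
have -> : D `^ (a + b - 1) = D `^ (a - 1) * D `^ (b - 1) * D.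
  by rewrite -powRDp// powR_mulr//; congr (_ `^ _); ring.
move: (Dp (a - 1)) (Dp (b - 1)) (Dn).
move: (D `^ (a - 1)) (D `^ (b - 1)) (D) => P Q d P0 Q0 d0.
by field; rewrite P0 Q0 d0.
Qed.

(** The involution [s -> x y / s] of [(x, y)] exchanges, up to powers of [x], [y]
    and [s], the factors [s^2 - x^2] and [y^2 - s^2], hence the two orders. *)
Lemma weyl_integral_reflection (a p b x y : R) : 0 < x < y ->
  weyl_integral a p b x y =
  ((x `^ (2 * a + p - 1) * y `^ (2 * b + p - 1))%:E
    * weyl_integral b (2 - 2 * a - 2 * b - p) a x y)%E.
Proof.
move=> /andP[x0 xy]; have y0 := lt_trans x0 xy.
rewrite [in RHS]/weyl_integral -ge0_integralZl_EFin; last 4 first.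
- by [].
- by move=> s _; rewrite lee_fin !mulr_ge0 ?powR_ge0.
- by apply/measurable_EFinP; exact: measurable_weyl_integrand.
- by rewrite mulr_ge0 ?powR_ge0.
have [u [v ex]] := itvoo_exhaustion xy.
pose F (s : R) := x * y * s^-1; pose dF (s : R) := x * y * - s ^- 2.
have xy0 : 0 < x * y by rewrite mulr_gt0.
have FI s : x < s < y -> x < F s < y.
  move=> /andP[xs sy]; have s0 := lt_trans x0 xs.
  rewrite /F; apply/andP; split; first by rewrite ltr_pdivlMr// ltr_pM2l.
  by rewrite ltr_pdivrMr// [x * y]mulrC ltr_pM2l.
have E : F @` (`]x, y[%classic : set R) = `]x, y[%classic.
  apply/seteqP; split => [_ [s /= sI <-]|t /=]; last rewrite in_itv/= => txy.
    by move: sI; rewrite !in_itv/=; exact: FI.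
  have t0 : 0 < t by case/andP: txy => ? _; exact: (lt_trans x0).
  exists (F t); first by rewrite /= in_itv/= FI.
  by rewrite /F; field; rewrite !gt_eqF.
have oI : open (`]x, y[%classic : set R) by exact: interval_open.
have dd (s : R) : `]x, y[%classic s -> is_derive s 1 F (dF s).
  rewrite /= in_itv/= => /andP[xs _]; have s0 := lt_trans x0 xs.
  have sn : s != 0 by rewrite gt_eqF.
  have d2 := is_deriveV (f := id) sn (is_derive_id s 1).
  rewrite /F /dF; apply: is_derive_eq; rewrite /GRing.scale/=; ring.
rewrite /weyl_integral -[in LHS]E (ge0_substitution_decr ex oI dd
  (G := fun s => (s ^+ 2 - x ^+ 2) `^ (a - 1) * s `^ p * (y ^+ 2 - s ^+ 2) `^ (b - 1))) ?E; last 6 first.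
- move=> s; rewrite /= in_itv/= => /andP[xs _]; have s0 := lt_trans x0 xs.
  apply: cvgM; first exact: cvg_cst.
  apply: cvgN; apply: cvgV; first by rewrite gt_eqF// exprn_gt0.
  exact: exprn_continuous.
- by move=> s _; rewrite /dF mulrN oppr_le0 mulr_ge0 ?(ltW xy0)// invr_ge0 sqr_ge0.
- move=> s t; rewrite /= !in_itv/= => /andP[xs _] /andP[xt _] st.
  by rewrite /F ltr_pM2l// ltf_pV2 ?posrE// (lt_trans x0).
- exact: interval_open.
- move=> s; rewrite /= in_itv/= => /andP[xs sy]; have s0 := lt_trans x0 xs.
  apply: cvgM; first apply: cvgM.
  + apply: (@continuous_comp _ _ _ (fun r : R => r ^+ 2 - x ^+ 2) (powR (R := R) ^~ (a - 1))).
      exact: continuous_sqr_sub.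
    by apply: powR_continuous_at; rewrite subr_gt0 sqr_lt.
  + exact: powR_continuous_at.
  + apply: (@continuous_comp _ _ _ (fun r : R => y ^+ 2 - r ^+ 2) (powR (R := R) ^~ (b - 1))).
      by apply: cvgB; [exact: cvg_cst|exact: exprn_continuous].
    by apply: powR_continuous_at; rewrite subr_gt0 sqr_lt.
- by move=> s _; rewrite !mulr_ge0 ?powR_ge0.
apply: eq_integral => s; rewrite inE/= in_itv/= => /andP[xs sy].
have s0 := lt_trans x0 xs.
have C0 : 0 < s ^+ 2 - x ^+ 2 by rewrite subr_gt0 sqr_lt.
have A0 : 0 < y ^+ 2 - s ^+ 2 by rewrite subr_gt0 sqr_lt.
have sn : s != 0 by rewrite gt_eqF.
have sp q : s `^ q != 0 by rewrite gt_eqF// powR_gt0.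
rewrite -EFinM; congr EFin.
have -> : F s ^+ 2 - x ^+ 2 = x ^+ 2 * (y ^+ 2 - s ^+ 2) / s ^+ 2 by rewrite /F; field.
have -> : y ^+ 2 - F s ^+ 2 = y ^+ 2 * (s ^+ 2 - x ^+ 2) / s ^+ 2 by rewrite /F; field.
have s20 : 0 < s ^+ 2 by rewrite exprn_gt0.
rewrite /F /dF !powR_div ?mulr_ge0 ?sqr_ge0 ?ltW//.
(* x ^+ 2 is x * x, so that its powers split into powers of x as well *)
rewrite !powRM ?sqr_ge0 ?(ltW x0) ?(ltW y0) ?(ltW C0) ?(ltW A0) ?(ltW s0)//.
have -> : x `^ (2 * a + p - 1) = x `^ (a - 1) * x `^ (a - 1) * x `^ p * x.
  by rewrite -!powRDp// powR_mulr//; congr (_ `^ _); ring.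
have -> : y `^ (2 * b + p - 1) = y `^ (b - 1) * y `^ (b - 1) * y `^ p * y.
  by rewrite -!powRDp// powR_mulr//; congr (_ `^ _); ring.
have -> : s `^ (2 - 2 * a - 2 * b - p) =
    (s `^ (a - 1) * s `^ (a - 1) * (s `^ (b - 1) * s `^ (b - 1)) * s `^ p * s * s)^-1.
  by rewrite -!powRDp// !powR_mulr// -powRN; congr (_ `^ _); ring.
move: (sp (a - 1)) (sp (b - 1)) (sp p) (sn).
move: (s `^ (a - 1)) (s `^ (b - 1)) (s `^ p) => P Q S P0 Q0 S0 s1.
by field; rewrite P0 Q0 S0 s1.
Qed.

End WeylKernels.

(** * The semigroup law of the fractional Bessel integrals *)

Section BesselKernel.
Context {R : realType}.
Local Notation mu := (@lebesgue_measure R).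
Variable nu : R.
Hypothesis nu_ge0 : 0 <= nu.

(** The factorized form of the Bessel kernel of order [a], for which the
    semigroup law can be proved; [weyl_besselE] identifies the two. *)
Definition weyl_bessel (a : R) : R * R -> \bar R :=
  kernel_scale (4 `^ (1 - a) / Gamma a ^+ 2)
    (kernel_comp (weyl_kernel a (2 - 2 * a - nu)) (weyl_kernel a nu)).

Opaque kernel_comp kernel_scale weyl_kernel weyl_integral.

Let scale_ge0 (a : R) : 0 <= 4 `^ (1 - a) / Gamma a ^+ 2.
Proof. by rewrite divr_ge0 ?powR_ge0// sqr_ge0. Qed.

Lemma ge0_weyl_bessel (a : R) : ge0_kernel (weyl_bessel a).
Proof.
apply: ge0_kernel_scale => //.
by apply: ge0_kernel_comp; exact: ge0_weyl_kernel.
Qed.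

Lemma weyl_bessel_eq0 (a x y : R) : ~~ (0 < x < y) -> weyl_bessel a (x, y) = 0%E.
Proof. by move=> xy; rewrite /weyl_bessel kernel_scaleE weyl_comp_eq0 ?mule0. Qed.

Lemma weyl_comp_beta (a b q : R) : 0 < a -> 0 < b ->
  kernel_comp (weyl_kernel a 1) (weyl_kernel b q) =
  kernel_scale (Gamma a * Gamma b / Gamma (a + b) / 2) (weyl_kernel (a + b) q).
Proof.
move=> a0 b0; apply/funext => -[x y].
have [xy|xy] := boolP (0 < x < y); last first.
  by rewrite weyl_comp_eq0// kernel_scaleE weyl_kernel_eq0// mule0.
rewrite weyl_compE// weyl_integral_beta// kernel_scaleE weyl_kernelE//.
by rewrite -!EFinM; congr EFin; ring.
Qed.

(** The middle pair of factors is exchanged by the reflection; the powers of the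
    end points that this produces are absorbed by the outer factors. *)
Lemma weyl_comp_swap (a b : R) :
  kernel_comp (weyl_kernel a (2 - 2 * a - nu))
    (kernel_comp (weyl_kernel a nu) (weyl_kernel b (2 - 2 * b - nu))) =
  kernel_comp (weyl_kernel a 1)
    (kernel_comp (weyl_kernel b (2 - 2 * (a + b) - nu)) (weyl_kernel a 1)).
Proof.
apply/funext => -[x r]; rewrite !kernel_compE; apply: eq_integral => s _.
have [xs|xs] := boolP (0 < x < s); last by rewrite !weyl_kernel_eq0 ?mul0e.
have [sr|sr] := boolP (0 < s < r); last by rewrite !weyl_comp_eq0 ?mule0.
rewrite !(weyl_kernelE _ _ xs) !(weyl_compE _ _ _ _ sr).
rewrite (weyl_integral_reflection _ _ _ sr).
have -> : 2 - 2 * a - 2 * b - nu = 2 - 2 * (a + b) - nu by ring.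
have s0 : 0 < s by case/andP: sr.
have r0 : 0 < r by case/andP: sr; exact: lt_trans.
rewrite !muleA -!EFinM; congr (EFin _ * _)%E.
rewrite !powRr1 ?ltW//.
have -> : 2 * b + nu - 1 = 1 + - (2 - 2 * b - nu) by ring.
have -> : 2 * a + nu - 1 = 1 + - (2 - 2 * a - nu) by ring.
move: (2 - 2 * a - nu) (2 - 2 * b - nu) => p q.
rewrite (powRDp _ _ s0) (powRDp _ _ r0) (powRr1 (ltW s0)) (powRr1 (ltW r0)) !powRN.
move: (powR_gt0 p s0) (powR_gt0 q r0) (_ `^ (a - 1)).
move: (s `^ _) (r `^ _) => P Q P0 Q0 A.
by field; rewrite !gt_eqF.
Qed.

(** After the exchange of [weyl_comp_swap], both the left pair and the right pair
    compose by the Beta integral, and the four orders [a], [a], [b], [b] become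
    two orders [a + b]. *)
Lemma weyl_bessel_comp (a b : R) : 0 < a -> 0 < b ->
  kernel_comp (weyl_bessel a) (weyl_bessel b) = weyl_bessel (a + b).
Proof.
move=> a0 b0; have gk := @ge0_weyl_kernel R.
rewrite /weyl_bessel.
rewrite (kernel_comp_four (scale_ge0 a) (scale_ge0 b) (gk _ _) (gk _ _) (gk _ _) (gk _ _)).
rewrite weyl_comp_swap.
have e0 : 0 <= Gamma a * Gamma b / Gamma (a + b) / 2.
  by rewrite !divr_ge0 ?mulr_ge0 ?ltW ?Gamma_gt0// addr_gt0.
rewrite (kernel_comp_regroup e0 (gk _ _) (gk _ _) (gk _ _) (gk _ _) (gk _ _)
  (gk _ _) (weyl_comp_beta _ a0 b0) (weyl_comp_beta _ a0 b0)).
rewrite kernel_scaleA; congr (kernel_scale _ _).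
have -> : 4 `^ (1 - (a + b)) = 4 `^ (1 - a) * 4 `^ (1 - b) / 4 :> R.
  have -> : 1 - (a + b) = (1 - a) + (1 - b) + - 1 by ring.
  by rewrite !(powRDp _ _ (ltr0n _ 4)) powR_inv1.
have Gn (c : R) : 0 < c -> Gamma c != 0 by move=> c0; rewrite gt_eqF// Gamma_gt0.
move: (Gn _ a0) (Gn _ b0) (Gn _ (addr_gt0 a0 b0)) (4 `^ _) (4 `^ _).
move: (Gamma a) (Gamma b) (Gamma (a + b)) => A B C A0 B0 C0 P Q.
by field; rewrite A0 B0 C0.
Qed.

(** Euler's integral with the parameters of the Bessel kernel; [nu >= 0] puts the
    exponent [a + (nu - 1)/2] above [-1]. *)
Lemma bessel_kernel_euler (a x y : R) : 0 < a -> 0 < x < y ->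
  let z := 1 - x ^+ 2 / y ^+ 2 in
  let w (t : R) := t `^ (a - 1) * (1 - t) `^ (a - 1)
             * (1 - z * t) `^ (- a - (nu - 1) / 2) in
  mu.-integrable `]0, 1[ (fun t => (w t)%:E) /\
  bessel_kernel nu a x y =
    ((y ^+ 2 - x ^+ 2) / (2 * y)) `^ (2 * a - 1) / Gamma a ^+ 2
    * \int[mu]_(t in `]0, 1[) w t.
Proof.
move=> a0 /andP[x0 xy] z w; have y0 := lt_trans x0 xy.
have z01 : 0 <= z < 1.
  rewrite /z subr_ge0 ler_pdivrMr ?exprn_gt0// mul1r ltW ?sqr_lt//=.
  by rewrite gtrBl divr_gt0// exprn_gt0.
have ac : 0 < a < 2 * a by rewrite a0/= mulr_natl mulr2n ltrDl.
have b1 : -1 < a + (nu - 1) / 2 by have := nu_ge0; have := a0; lra.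
have [] := euler_integral ac b1 z01; rewrite /=.
have -> : 2 * a - a = a by ring.
have -> : - (a + (nu - 1) / 2) = - a - (nu - 1) / 2 by ring.
rewrite -/w => iw wE; split => //.
rewrite /bessel_kernel -/z wE.
move: (Gamma_gt0 a0) (Gamma_gt0 (lt_trans a0 (proj2 (andP ac)))).
move: (Gamma a) (Gamma (2 * a)) (hyp2F1 _ _ _ _) => A B H A0 B0.
by field; rewrite !gt_eqF.
Qed.

(** The substitution [t = (y^2 - s^2) / (y^2 - x^2)] carries the integral of the
    factorized kernel to Euler's integral. *)
Lemma weyl_besselE (a x y : R) : 0 < a -> 0 < x < y ->
  weyl_bessel a (x, y) = (bessel_kernel nu a x y)%:E.
Proof.
move=> a0 /[dup] xy0 /andP[x0 xy]; have y0 := lt_trans x0 xy.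
pose z := 1 - x ^+ 2 / y ^+ 2.
pose q := - a - (nu - 1) / 2.
pose w (t : R) := t `^ (a - 1) * (1 - t) `^ (a - 1) * (1 - z * t) `^ q.
have [iw ->] : mu.-integrable `]0, 1[ (fun t => (w t)%:E) /\
    bessel_kernel nu a x y =
    ((y ^+ 2 - x ^+ 2) / (2 * y)) `^ (2 * a - 1) / Gamma a ^+ 2
    * \int[mu]_(t in `]0, 1[) w t := bessel_kernel_euler a0 xy0.
rewrite EFinM /Rintegral fineK; last first.
  have H := integrable_fin_num _ iw; apply: H.
  exact: measurable_itv.
rewrite /weyl_bessel kernel_scaleE weyl_compE//.
have -> (p : R) : weyl_integral a p a x y = (\int[mu]_(s in `]x, y[)
    ((s ^+ 2 - x ^+ 2) `^ (a - 1) * s `^ p * (y ^+ 2 - s ^+ 2) `^ (a - 1))%:E)%E by [].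
set D := y ^+ 2 - x ^+ 2.
have D0 : 0 < D by rewrite subr_gt0 sqr_lt.
have Dn : D != 0 by rewrite gt_eqF.
have Dp p : D `^ p != 0 by rewrite gt_eqF// powR_gt0.
have yp p : y `^ p != 0 by rewrite gt_eqF// powR_gt0.
have G0 := Gamma_gt0 a0.
pose F (s : R) := (s ^+ 2 - y ^+ 2) / - D.
have [u [v ex]] := itvoo_exhaustion xy.
have FE s : F s = (y ^+ 2 - s ^+ 2) / D by rewrite /F; field.
have E : F @` (`]x, y[%classic : set R) = `]0, 1[%classic.
  apply/seteqP; split => [_ [s /= sI <-]|t /=]; last rewrite in_itv/= => /andP[t0 t1].
    move: sI; rewrite !in_itv/= => /andP[xs sy].
    have s0 := lt_trans x0 xs.
    by rewrite FE divr_gt0 ?subr_gt0 ?sqr_lt//= ltr_pdivrMr// mul1r ltrD2l ltrN2 sqr_lt.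
  have tD : 0 < t * D by rewrite mulr_gt0.
  have tD1 : t * D < D by rewrite gtr_pMl.
  have ytD : 0 < y ^+ 2 - t * D.
    by rewrite subr_gt0 (lt_trans tD1)// gtrBl exprn_gt0.
  exists (Num.sqrt (y ^+ 2 - t * D)); last first.
    by rewrite FE sqr_sqrtr ?ltW// subKr mulfK.
  rewrite /= in_itv/=; apply/andP; split.
  - rewrite -[ltLHS]gtr0_norm// -sqrtr_sqr ltr_sqrt//.
    by rewrite ltrBrDr -ltrBrDl.
  - rewrite -[ltRHS]gtr0_norm// -sqrtr_sqr ltr_sqrt ?exprn_gt0//.
    by rewrite gtrBl.
have oI : open (`]x, y[%classic : set R) by exact: interval_open.
have dd (s : R) : `]x, y[%classic s -> is_derive s 1 F (2 * s / - D).
  by move=> _; exact: is_derive_sqr_sub.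
have zt t : 0 < t < 1 -> 0 < 1 - z * t.
  move=> /andP[t0 t1]; rewrite subr_gt0 (@lt_trans _ _ z)//.
    by rewrite gtr_pMr// /z subr_gt0 ltr_pdivrMr ?exprn_gt0// mul1r sqr_lt.
  by rewrite /z gtrBl divr_gt0// exprn_gt0.
rewrite -[in RHS]E (ge0_substitution_decr ex oI dd (G := w)) ?E; last 6 first.
- move=> s _; apply: cvgM; last exact: cvg_cst.
  by apply: cvgM; [exact: cvg_cst|exact: cvg_id].
- move=> s; rewrite /= in_itv/= => /andP[xs _].
  by rewrite invrN mulrN oppr_le0 divr_ge0 ?mulr_ge0 ?ltW// (lt_trans x0 xs).
- move=> s t; rewrite /= !in_itv/= => /andP[xs _] _ st.
  by rewrite !FE ltr_pM2r ?invr_gt0// ltrD2l ltrN2 sqr_lt// (lt_trans x0 xs).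
- exact: interval_open.
- move=> t; rewrite /= in_itv/= => /[dup] t01 /andP[t0 t1]; apply: cvgM; first apply: cvgM.
  + exact: powR_continuous_at.
  + apply: (@continuous_comp _ _ _ (fun r : R => 1 - r) (powR (R := R) ^~ (a - 1))).
      by apply: cvgB; [exact: cvg_cst|exact: cvg_id].
    by apply: powR_continuous_at; rewrite subr_gt0.
  + apply: (@continuous_comp _ _ _ (fun r : R => 1 - z * r) (powR (R := R) ^~ q)).
      apply: cvgB; first exact: cvg_cst.
      by apply: cvgM; [exact: cvg_cst|exact: cvg_id].
    by apply: powR_continuous_at; exact: zt.
- by move=> t _; rewrite !mulr_ge0 ?powR_ge0.
rewrite muleA -EFinM -!ge0_integralZl_EFin; last 8 first.
- by [].
- move=> s; rewrite /= in_itv/= => /andP[xs _]; rewrite lee_fin mulr_ge0 ?mulr_ge0 ?powR_ge0//.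
  by rewrite invrN mulrN opprK divr_ge0 ?mulr_ge0 ?ltW// (lt_trans x0 xs).
- apply/measurable_EFinP; apply: measurable_funTS; apply: measurable_funM.
    apply: (measurableT_comp (f := w)).
      apply: measurable_funM; last first.
        apply: (measurableT_comp (measurable_powR _)) => //.
        by apply: measurable_funB => //; exact: measurable_funM.
      apply: measurable_funM; first exact: measurable_powR.
      exact: measurable_powR_onem.
    by apply: measurable_funM => //; apply: measurable_funB => //; exact: measurable_funX.
  by apply: measurableT_comp => //; apply: measurable_funM => //; exact: measurable_funM.
- by rewrite divr_ge0 ?powR_ge0 ?sqr_ge0.
- by [].
- by move=> s _; rewrite lee_fin !mulr_ge0 ?powR_ge0.
- by apply/measurable_EFinP; exact: measurable_weyl_integrand.
- by rewrite mulr_ge0 ?powR_ge0.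
apply: eq_integral => s; rewrite inE/= in_itv/= => /andP[xs sy].
have s0 := lt_trans x0 xs.
have C0 : 0 < s ^+ 2 - x ^+ 2 by rewrite subr_gt0 sqr_lt.
have A0 : 0 < y ^+ 2 - s ^+ 2 by rewrite subr_gt0 sqr_lt.
rewrite -!EFinM; congr EFin; rewrite /w.
have -> : 1 - F s = (s ^+ 2 - x ^+ 2) / D by rewrite FE /D; field.
have -> : 1 - z * F s = s ^+ 2 / y ^+ 2.
  by rewrite FE /z /D; field; rewrite gt_eqF//= -/D.
rewrite FE !powR_div ?(ltW A0) ?(ltW C0) ?sqr_ge0 ?exprn_gt0 ?(ltW D0) ?mulr_gt0//.
rewrite !powRM ?(ltW s0) ?(ltW y0)//.
have -> : 4 `^ (1 - a) = 2 / 2 `^ (2 * a - 1) :> R.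
  have -> : 4 = 2 ^+ 2 :> R by rewrite -natrX.
  by rewrite powR_sqr// -powRN [RHS]mulrC powR_mulr//; congr (_ `^ _); ring.
have -> : y `^ nu = (y `^ (2 * a - 1) * (y `^ q * y `^ q))^-1.
  by rewrite -!powRDp// -powRN; congr (_ `^ _); rewrite /q; field.
have -> : s `^ (2 - 2 * a - nu) = s `^ q * s `^ q * s.
  by rewrite -!powRDp// powR_mulr//; congr (_ `^ _); rewrite /q; field.
have -> : D `^ (2 * a - 1) = D `^ (a - 1) * D `^ (a - 1) * D.
  by rewrite -!powRDp// powR_mulr//; congr (_ `^ _); ring.
have T0 : 2 `^ (2 * a - 1) != 0 :> R by rewrite gt_eqF// powR_gt0.
move: (Dp (a - 1)) (yp (2 * a - 1)) (yp q) (Dn) T0 (gt_eqF G0).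
move: (D `^ (a - 1)) (y `^ (2 * a - 1)) (y `^ q) (D) (2 `^ _) (Gamma a) (s `^ q).
move=> P Q S d T G U P0 Q0 S0 d0 T0 G1.
by field; rewrite P0 Q0 S0 d0 T0 G1.
Qed.

Transparent kernel_comp kernel_scale weyl_kernel weyl_integral.

End BesselKernel.

(** * Linearity of the complex integral *)

Section ComplexIntegralLinear.
Context {R : realType}.
Local Notation mu := (@lebesgue_measure R).
Implicit Types (D : set R) (h : R -> R[i]).

Lemma eq_cintegral D h1 h2 : {in D, h1 =1 h2} -> cintegral D h1 = cintegral D h2.
Proof.
by move=> e; rewrite /cintegral; congr (_ +i* _); apply: eq_Rintegral => t tD; rewrite e.
Qed.

Lemma eq_cintegrable D h1 h2 : measurable D -> {in D, h1 =1 h2} ->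
  cintegrable D h1 -> cintegrable D h2.
Proof.
move=> mD e [i1 i2]; split; [apply: eq_integrable i1|apply: eq_integrable i2] => //;
  by move=> t tD; rewrite e.
Qed.

Lemma ReM (z w : R[i]) :
  complex.Re (z * w) = complex.Re z * complex.Re w - complex.Im z * complex.Im w.
Proof. by case: z; case: w. Qed.

Lemma ImM (z w : R[i]) :
  complex.Im (z * w) = complex.Re z * complex.Im w + complex.Im z * complex.Re w.
Proof. by case: z => a b; case: w => c d. Qed.

Lemma Re_realM (a : R) (w : R[i]) : complex.Re (a%:C * w) = a * complex.Re w.
Proof. by rewrite ReM mul0r subr0. Qed.

Lemma Im_realM (a : R) (w : R[i]) : complex.Im (a%:C * w) = a * complex.Im w.
Proof. by rewrite ImM mul0r addr0. Qed.

Lemma cintegral_scale D h (c : R[i]) : measurable D -> cintegrable D h ->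
  cintegrable D (fun t => c * h t) /\
  cintegral D (fun t => c * h t) = c * cintegral D h.
Proof.
move=> mD [i1 i2].
have iZ (a : R) (g : R -> R) : mu.-integrable D (fun t => (g t)%:E) ->
    mu.-integrable D (EFin \o (fun t => a * g t)).
  move=> ig; have H := @integrableZl _ (measurableTypeR R) R mu D mD a _ ig.
  exact: H.
split.
  split.
  - have := @integrableB _ (measurableTypeR R) R mu D mD _ _
      (iZ (complex.Re c) _ i1) (iZ (complex.Im c) _ i2).
    by apply: eq_integrable => // t _; rewrite /= ReM EFinB.
  - have := @integrableD _ (measurableTypeR R) R mu D mD _ _
      (iZ (complex.Re c) _ i2) (iZ (complex.Im c) _ i1).
    by apply: eq_integrable => // t _; rewrite /= ImM EFinD.
rewrite /cintegral.
have -> : \int[mu]_(t in D) complex.Re (c * h t) =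
    complex.Re c * (\int[mu]_(t in D) complex.Re (h t)) -
    complex.Im c * (\int[mu]_(t in D) complex.Im (h t)).
  rewrite -!RintegralZl// -RintegralB//; [|exact: iZ|exact: iZ].
  by apply: eq_Rintegral => t _; rewrite ReM.
have -> : \int[mu]_(t in D) complex.Im (c * h t) =
    complex.Re c * (\int[mu]_(t in D) complex.Im (h t)) +
    complex.Im c * (\int[mu]_(t in D) complex.Re (h t)).
  rewrite -!RintegralZl// -RintegralD//; [|exact: iZ|exact: iZ].
  by apply: eq_Rintegral => t _; rewrite ImM.
by case: c {iZ} => a b.
Qed.

Lemma cintegral_real D (g : R -> R) :
  cintegral D (fun t => (g t)%:C) = (\int[mu]_(t in D) g t)%:C.
Proof.
rewrite /cintegral /=; congr (_ +i* _).
by rewrite /Rintegral integral0_eq.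
Qed.

End ComplexIntegralLinear.

(** * Convergence of the Mittag-Leffler series *)

Section MittagLeffler.
Context {R : realType}.
Variable alpha : R.
Hypothesis alpha_gt0 : 0 < alpha.

(** The geometric series is the binomial series of exponent [1]. *)
Lemma binomial_coef1 n : binomial_coef (1 : R) n = 1.
Proof.
suff : rising_fact (1 : R) n = n`!%:R.
  by rewrite /binomial_coef => ->; rewrite divff// gt_eqF// factr_gt0.
elim: n => [|n ih]; first by rewrite /rising_fact big_ord0.
by rewrite rising_factS ih factS natrM mulrC -addn1 natrD addrC.
Qed.

(** [Gamma_ge] at a point [T] with [T^(2 alpha) = 2M + 1] bounds the terms by a
    geometric series of ratio [M / (2M + 1) <= 1/2]. *)
Lemma mittag_leffler_abs_summable (M : R) : 0 <= M ->
  (\sum_(k <oo) (M ^+ k / Gamma (alpha + k%:R * alpha) ^+ 2)%:E < +oo)%E.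
Proof.
move=> M0; pose Q := 2 * M + 1.
have Q0 : 0 < Q by rewrite ltr_wpDl// mulr_ge0.
pose T := Q `^ (2 * alpha)^-1.
have T0 : 0 < T by rewrite powR_gt0.
pose c := expR (- (T + 1)) / (T + 1).
have c0 : 0 < c by rewrite divr_gt0 ?expR_gt0// addr_gt0.
have a0 k : 0 < alpha + k%:R * alpha.
  by rewrite ltr_wpDr// mulr_ge0// ltW.
have G0 k : 0 < Gamma (alpha + k%:R * alpha) by exact: Gamma_gt0.
have key k : c ^+ 2 * Q ^+ k.+1 <= Gamma (alpha + k%:R * alpha) ^+ 2.
  have := Gamma_ge (a0 k) T0; set G := Gamma _.
  have -> : T `^ (alpha + k%:R * alpha) / (T + 1) * expR (- (T + 1)) =
     c * T `^ (alpha + k%:R * alpha) by rewrite /c; ring.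
  move=> h; have -> : c ^+ 2 * Q ^+ k.+1 = (c * T `^ (alpha + k%:R * alpha)) ^+ 2.
    rewrite [RHS]exprMn; congr (_ * _).
    rewrite -[RHS]powR_mulrn ?powR_ge0// -!powRrM.
    rewrite -[LHS](powR_mulrn k.+1 (ltW Q0)); congr (_ `^ _).
    by rewrite -[k.+1]addn1 natrD; field; rewrite gt_eqF.
  by rewrite lerXn2r// nnegrE ?(ltW (G0 k))// mulr_ge0 ?powR_ge0 ?(ltW c0).
clearbody c; have x01 : 0 <= (2^-1 : R) < 1 by rewrite invr_ge0 ler0n/= invf_lt1// ltr1n.
apply: (@le_lt_trans _ _ (\sum_(k <oo) ((c ^+ 2 * Q)^-1)%:E * (binomial_coef 1 k * 2^-1 ^+ k)%:E)%E).
  apply: lee_nneseries => [k _ _|k _].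
    by rewrite lee_fin divr_ge0 ?exprn_ge0 ?(ltW (G0 k)).
  rewrite -EFinM lee_fin binomial_coef1 mul1r.
  have cQ : 0 < c ^+ 2 * Q ^+ k.+1 by rewrite mulr_gt0// exprn_gt0.
  apply: (@le_trans _ _ (M ^+ k / (c ^+ 2 * Q ^+ k.+1))).
    by rewrite ler_wpM2l ?exprn_ge0// lef_pV2 ?posrE// exprn_gt0.
  have -> : M ^+ k / (c ^+ 2 * Q ^+ k.+1) = (c ^+ 2 * Q)^-1 * (M / Q) ^+ k.
    rewrite (exprS Q k) expr_div_n; move: (lt0r_neq0 (exprn_gt0 k Q0)) (lt0r_neq0 c0).
    move: (lt0r_neq0 Q0) (Q ^+ k) (M ^+ k) => Qn S P Sn cn.
    by field; rewrite Sn cn Qn.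
  rewrite ler_wpM2l ?invr_ge0 ?mulr_ge0 ?(ltW c0) ?(ltW Q0)//.
  rewrite lerXn2r// ?nnegrE ?divr_ge0 ?(ltW Q0)//.
  by rewrite ler_pdivrMr// /Q; have := M0; lra.
rewrite nneseriesZl; last first.
  by move=> k _; rewrite lee_fin binomial_coef1 mul1r exprn_ge0 ?invr_ge0.
by rewrite nneseries_binomial// -EFinM ltry.
Qed.

End MittagLeffler.

(** * Iterates of the fractional Bessel integral *)

Section Iterates.
Context {R : realType}.
Local Notation mu := (@lebesgue_measure R).
Variables nu alpha : R.
Hypotheses (nu_ge0 : 0 <= nu) (alpha_gt0 : 0 < alpha).

Opaque weyl_bessel bessel_kernel.

(** The kernel of the [n+1]-st iterate. *)
Definition iter_kernel (n : nat) : R * R -> \bar R :=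
  locked (weyl_bessel nu (alpha + n%:R * alpha)).

Let order_gt0 n : 0 < alpha + n%:R * alpha.
Proof. by rewrite ltr_wpDr// mulr_ge0// ltW. Qed.

Lemma ge0_iter_kernel n : ge0_kernel (iter_kernel n).
Proof. by rewrite /iter_kernel -lock; exact: ge0_weyl_bessel. Qed.

Lemma iter_kernelE n (x y : R) : 0 < x < y ->
  iter_kernel n (x, y) = (bessel_kernel nu (alpha + n%:R * alpha) x y)%:E.
Proof. by move=> xy; rewrite /iter_kernel -lock weyl_besselE. Qed.

Lemma iter_kernel0E (x y : R) : 0 < x < y ->
  iter_kernel 0 (x, y) = (bessel_kernel nu alpha x y)%:E.
Proof. by move=> xy; rewrite iter_kernelE// mul0r addr0. Qed.

Lemma iter_kernel_eq0 n (x y : R) : ~~ (0 < x < y) -> iter_kernel n (x, y) = 0%E.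
Proof. by rewrite /iter_kernel -lock; exact: weyl_bessel_eq0. Qed.

Lemma iter_kernel_fin n (x y : R) : iter_kernel n (x, y) \is a fin_num.
Proof.
by have [xy|xy] := boolP (0 < x < y); [rewrite iter_kernelE|rewrite iter_kernel_eq0].
Qed.

Lemma iter_kernelS n :
  kernel_comp (iter_kernel 0) (iter_kernel n) = iter_kernel n.+1.
Proof.
have E m : iter_kernel m = weyl_bessel nu (alpha + m%:R * alpha).
  by rewrite /iter_kernel -lock.
transitivity (weyl_bessel nu ((alpha + 0%:R * alpha) + (alpha + n%:R * alpha))).
  by rewrite (E 0) (E n); exact: weyl_bessel_comp.
rewrite (E n.+1); congr (weyl_bessel _ _).
by rewrite -[n.+1]addn1 natrD; ring.
Qed.

Lemma integral_iter_kernel n (h : R -> \bar R) (x : R) : 0 < x ->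
  (\int[mu]_(y in `]x, +oo[)
     ((bessel_kernel nu (alpha + n%:R * alpha) x y)%:E * h y) =
   kernel_int (iter_kernel n) h x)%E.
Proof.
move=> x0; rewrite integral_mkcond; apply: eq_integral => y _; rewrite patchE.
rewrite mem_setE in_itv/= andbT; case: ifPn => xy.
  by rewrite iter_kernelE// x0.
by rewrite iter_kernel_eq0 ?mul0e// x0.
Qed.

Lemma integrable_iter_kernel n (h : R -> \bar R) (x : R) : 0 < x ->
  mu.-integrable setT (fun y => iter_kernel n (x, y) * h y)%E ->
  mu.-integrable `]x, +oo[
    (fun y => (bessel_kernel nu (alpha + n%:R * alpha) x y)%:E * h y)%E.
Proof.
move=> x0 ih; have : mu.-integrable `]x, +oo[ (fun y => iter_kernel n (x, y) * h y)%E.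
  by apply: integrableS ih => //; exact: measurable_itv.
apply: eq_integrable => // y; rewrite inE/= in_itv/= andbT => xy.
by rewrite iter_kernelE// x0.
Qed.

Lemma bessel_int_ge0E (h : R -> \bar R) (x : R) : 0 < x ->
  bessel_int_ge0 nu alpha h x = kernel_int (iter_kernel 0) h x.
Proof.
by move=> x0; rewrite -(integral_iter_kernel 0 h x0) mul0r addr0.
Qed.

Lemma eq_kernel_int n (h1 h2 : R -> \bar R) (x : R) :
  (forall y, 0 < y -> h1 y = h2 y) ->
  kernel_int (iter_kernel n) h1 x = kernel_int (iter_kernel n) h2 x.
Proof.
move=> e; apply: eq_integral => y _.
have [/andP[x0 xy]|xy] := boolP (0 < x < y); last by rewrite iter_kernel_eq0 ?mul0e.
by rewrite e// (lt_trans x0).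
Qed.

Definition real_bessel_int (u : R -> R) (x : R) : R :=
  \int[mu]_(y in `]x, +oo[) (bessel_kernel nu alpha x y * u y).

Lemma real_bessel_intE (u : R -> R) (x : R) : 0 < x ->
  real_bessel_int u x = fine (kernel_int (iter_kernel 0) (EFin \o u) x).
Proof.
move=> x0; rewrite -(integral_iter_kernel 0 _ x0) mul0r addr0 /real_bessel_int /Rintegral.
by congr fine; apply: eq_integral => y _; rewrite EFinM.
Qed.

(** For a function [u] of arbitrary sign, Fubini's theorem replaces Tonelli's; it
    applies because all iterates of [|u|] are finite. *)
Section RealIterates.
Variable u : R -> R.
Hypothesis mu_u : measurable_fun setT u.
Hypothesis finu : forall n (x : R), 0 < x ->
  (kernel_int (iter_kernel n) (fun y => `|u y|%:E) x < +oo)%E.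

Lemma integrable_iter_kernelT n (x : R) : 0 < x ->
  mu.-integrable setT (fun y => iter_kernel n (x, y) * (u y)%:E)%E.
Proof.
move=> x0; apply/integrableP; split.
  apply: emeasurable_funM; first by apply: ge0_kernel_left; exact: ge0_iter_kernel.
  exact/measurable_EFinP.
apply: le_lt_trans (finu n x0); rewrite le_eqVlt; apply/orP; left; apply/eqP.
apply: eq_integral => y _; rewrite abseM gee0_abs//.
by case: (ge0_iter_kernel n).
Qed.

Let G n x (z : R * R) : \bar R :=
  (iter_kernel 0 (x, z.1) * (iter_kernel n z * (u z.2)%:E))%E.

Let integrable_G n (x : R) : 0 < x ->
  (mu \x mu)%E.-integrable setT (G n x).
Proof.
move=> x0; have mG : measurable_fun setT (G n x).
  apply: emeasurable_funM.
    apply: (measurableT_comp (ge0_kernel_left x (ge0_iter_kernel 0))).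
    exact: measurable_fst.
  apply: emeasurable_funM; first by case: (ge0_iter_kernel n).
  by apply/measurable_EFinP; exact: (measurableT_comp mu_u).
apply/(@integrable12ltyP _ _ (measurableTypeR R) (measurableTypeR R) R mu mu _ mG).
apply: le_lt_trans (finu n.+1 x0).
rewrite -iter_kernelS -kernel_int_comp; last 4 first.
- exact: ge0_iter_kernel.
- exact: ge0_iter_kernel.
- by apply/measurable_EFinP; exact: measurableT_comp.
- by move=> y; rewrite lee_fin.
rewrite le_eqVlt; apply/orP; left; apply/eqP.
have k0 m z : (0 <= iter_kernel m z)%E by case: (ge0_iter_kernel m).
apply: eq_integral => y _; rewrite /kernel_int -ge0_integralZl//.
- apply: eq_integral => w _; rewrite /G (abseM (iter_kernel 0 _)) (abseM (iter_kernel n _)).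
  by rewrite (gee0_abs (k0 _ _)) (gee0_abs (k0 _ _)).
- apply: emeasurable_funM; first by apply: ge0_kernel_left; exact: ge0_iter_kernel.
  by apply/measurable_EFinP; exact: measurableT_comp.
- by move=> w _; rewrite mule_ge0 ?lee_fin//; case: (ge0_iter_kernel n).
Qed.

Let integral_G_left n (x y : R) : 0 < x ->
  (\int[mu]_w G n x (y, w) =
   iter_kernel 0 (x, y) * kernel_int (iter_kernel n) (EFin \o u) y)%E.
Proof.
move=> x0; have [/[dup] xy0 /andP[_ xy]|xy] := boolP (0 < x < y); last first.
  by rewrite integral0_eq ?iter_kernel_eq0 ?mul0e// => w _; rewrite /G iter_kernel_eq0 ?mul0e.
have iy := integrable_iter_kernelT n (lt_trans x0 xy).
rewrite /G /= (iter_kernel0E xy0).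
by have H := integralZl _ iy (bessel_kernel nu alpha x y); apply: H.
Qed.

Let integral_G_right n (x w : R) : 0 < x ->
  (\int[mu]_y G n x (y, w) = iter_kernel n.+1 (x, w) * (u w)%:E)%E.
Proof.
move=> x0; have k0 m z : (0 <= iter_kernel m z)%E by case: (ge0_iter_kernel m).
have ik : mu.-integrable setT (fun y => iter_kernel 0 (x, y) * iter_kernel n (y, w))%E.
  apply/integrableP; split.
    apply: emeasurable_funM.
      by apply: ge0_kernel_left; exact: ge0_iter_kernel.
    by apply: ge0_kernel_right; exact: ge0_iter_kernel.
  have := iter_kernel_fin n.+1 x w; rewrite -iter_kernelS ge0_fin_numE; last first.
    by case: (ge0_kernel_comp (ge0_iter_kernel 0) (ge0_iter_kernel n)).
  apply: le_lt_trans; rewrite le_eqVlt; apply/orP; left; apply/eqP.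
  by apply: eq_integral => y _; rewrite gee0_abs// mule_ge0.
rewrite -iter_kernelS muleC.
transitivity (\int[mu]_y ((u w)%:E * (iter_kernel 0 (x, y) * iter_kernel n (y, w))))%E.
  by apply: eq_integral => y _; rewrite /G /= muleA muleC.
by have H := integralZl _ ik (u w); apply: H.
Qed.

Let kernel_int_iter_kernel n (x : R) : 0 < x ->
  kernel_int (iter_kernel 0) (kernel_int (iter_kernel n) (EFin \o u)) x =
  kernel_int (iter_kernel n.+1) (EFin \o u) x.
Proof.
move=> x0; transitivity (\int[mu]_y \int[mu]_w G n x (y, w))%E.
  by apply: eq_integral => y _; rewrite integral_G_left.
rewrite [LHS](@Fubini _ _ (measurableTypeR R) (measurableTypeR R) R mu mu _ (integrable_G n x0)).
by apply: eq_integral => w _; rewrite integral_G_right.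
Qed.

Lemma iter_real_bessel_int n (x : R) : 0 < x ->
  (iter n.+1 real_bessel_int u x)%:E = kernel_int (iter_kernel n) (EFin \o u) x.
Proof.
elim: n x => [|n ih] x x0.
  rewrite iterS (real_bessel_intE _ x0) fineK//.
  by have H := integrable_fin_num _ (integrable_iter_kernelT 0 x0); apply: H.
rewrite iterS (real_bessel_intE _ x0) fineK.
  transitivity (kernel_int (iter_kernel 0) (kernel_int (iter_kernel n) (EFin \o u)) x);
    last exact: kernel_int_iter_kernel.
  by apply: eq_kernel_int => y y0; exact: ih.
have -> : kernel_int (iter_kernel 0) (EFin \o iter n.+1 real_bessel_int u) x =
    kernel_int (iter_kernel n.+1) (EFin \o u) x.
  transitivity (kernel_int (iter_kernel 0) (kernel_int (iter_kernel n) (EFin \o u)) x);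
    last exact: kernel_int_iter_kernel.
  by apply: eq_kernel_int => y y0; exact: ih.
by have H := integrable_fin_num _ (integrable_iter_kernelT n.+1 x0); apply: H.
Qed.

(** The inner integral of an absolutely convergent double integral is integrable
    in the outer variable. *)
Lemma integrable_iter_real_bessel_int n (x : R) : 0 < x ->
  mu.-integrable setT
    (fun y => iter_kernel 0 (x, y) * (iter n real_bessel_int u y)%:E)%E.
Proof.
case: n => [|n] x0; first exact: integrable_iter_kernelT.
have := @integrable_fubini_F _ _ (measurableTypeR R) (measurableTypeR R) R mu mu
  _ (integrable_G n x0).
apply: eq_integrable => // y _.
transitivity (iter_kernel 0 (x, y) * kernel_int (iter_kernel n) (EFin \o u) y)%E.
  exact: integral_G_left.
have [/andP[_ xy]|xy] := boolP (0 < x < y); last by rewrite iter_kernel_eq0 ?mul0e.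
by rewrite -iter_real_bessel_int// (lt_trans x0).
Qed.

End RealIterates.

Transparent weyl_bessel bessel_kernel.

End Iterates.

(** * The Mittag-Leffler integral as a series of kernels *)

Lemma cintegral_series_integrable (R : realType) (D : set R) (F : nat -> R -> R[i]) :
  measurable D -> (forall k, cintegrable D (F k)) ->
  (forall t, D t -> csummable (F ^~ t)) ->
  (\sum_(k <oo) \int[lebesgue_measure]_(t in D) (cabs (F k t))%:E < +oo)%E ->
  cintegrable D (fun t => csum (F ^~ t)) /\
  series ((fun k => cintegral D (F k)) : (R[i]^o)^nat) @ \oo -->
    (cintegral D (fun t => csum (F ^~ t)) : R[i]^o).
Proof.
move=> mD iF; apply: cintegral_series => // k.
- by case: (iF k) => /measurable_int/measurable_EFinP.
- by case: (iF k) => _ /measurable_int/measurable_EFinP.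
Qed.

Section InnerIntegral.
Context {R : realType}.
Local Notation mu := (@lebesgue_measure R).
Variables (nu alpha x y : R) (lambda : R[i]).
Hypotheses (nu_ge0 : 0 <= nu) (alpha_gt0 : 0 < alpha) (xy : 0 < x < y).

Let z := 1 - x ^+ 2 / y ^+ 2.
Let D := y ^+ 2 - x ^+ 2.
Let E := D / (2 * y).

(** The integrand of Euler's integral for the Bessel kernel of order [a]. *)
Definition euler_weight (a t : R) : R :=
  t `^ (a - 1) * (1 - t) `^ (a - 1)
  * (1 - (1 - x ^+ 2 / y ^+ 2) * t) `^ (- a - (nu - 1) / 2).

(** The factor by which Euler's integrand grows when the order increases by
    [alpha], up to the power of [(y^2 - x^2)/(2y)] that the kernel carries. *)
Definition euler_ratio (t : R) : R :=
  (4^-1 * (t * (1 - t) * (y ^+ 2 - x ^+ 2) ^+ 2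
    / (y ^+ 2 - (y ^+ 2 - x ^+ 2) * t))) `^ alpha.

Definition mittag_leffler_term (t : R) (k : nat) : R[i] :=
  (lambda^-1 * (euler_ratio t)%:C) ^+ k
  / (\prod_(i < 2) Gamma (alpha + k%:R * alpha))%:C.

Let x0 : 0 < x. Proof. by case/andP: xy. Qed.
Let y0 : 0 < y. Proof. by case/andP: xy; exact: lt_trans. Qed.
Let D0 : 0 < D. Proof. by case/andP: xy => ? ?; rewrite subr_gt0 sqr_lt. Qed.
Let E0 : 0 < E. Proof. by rewrite divr_gt0 ?mulr_gt0. Qed.
Let order_gt0 k : 0 < alpha + k%:R * alpha.
Proof. by rewrite ltr_wpDr// mulr_ge0// ltW. Qed.

Let G2 k : R := Gamma (alpha + k%:R * alpha) ^+ 2.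
Let G2_gt0 k : 0 < G2 k. Proof. by rewrite exprn_gt0// Gamma_gt0. Qed.

Let zE : z = D / y ^+ 2.
Proof. by rewrite /z /D; field; rewrite gt_eqF. Qed.

Let zt_gt0 t : 0 < t < 1 -> 0 < 1 - z * t.
Proof.
move=> /andP[t0 t1]; rewrite subr_gt0 zE (@lt_trans _ _ (D / y ^+ 2))//.
  by rewrite gtr_pMr// divr_gt0// exprn_gt0.
by rewrite ltr_pdivrMr ?exprn_gt0// mul1r /D gtrBl exprn_gt0.
Qed.

Let weight_ge0 a t : 0 <= euler_weight a t.
Proof. by rewrite /euler_weight !mulr_ge0 ?powR_ge0. Qed.

Let ratio_ge0 t : 0 <= euler_ratio t.
Proof. exact: powR_ge0. Qed.

(** With [E = (y^2 - x^2)/(2y)] and [z = 1 - x^2/y^2], the ratio is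
    [(E^2 t (1-t) / (1 - zt))^alpha], so that its [k]-th power adds
    [k alpha] to the first two exponents of the weight and subtracts it from
    the third. *)
Let weight_ratio k t : 0 < t < 1 ->
  euler_weight alpha t * euler_ratio t ^+ k =
  E `^ (2 * (k%:R * alpha)) * euler_weight (alpha + k%:R * alpha) t.
Proof.
move=> t01; have z1 := zt_gt0 t01; case/andP: t01 => t0 t1.
have t1' : 0 < 1 - t by rewrite subr_gt0.
have -> : euler_ratio t ^+ k =
    t `^ (k%:R * alpha) * (1 - t) `^ (k%:R * alpha) *
    (1 - z * t) `^ (- (k%:R * alpha)) * E `^ (2 * (k%:R * alpha)).
  rewrite /euler_ratio -/D.
  have -> : 4^-1 * (t * (1 - t) * D ^+ 2 / (y ^+ 2 - D * t)) =
      t * (1 - t) / (1 - z * t) * E ^+ 2.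
    have h : y ^+ 2 - D * t != 0.
      have -> : y ^+ 2 - D * t = y ^+ 2 * (1 - z * t).
        by rewrite zE; field; rewrite gt_eqF.
      by rewrite gt_eqF// mulr_gt0// exprn_gt0.
    by rewrite zE /E; field; rewrite h gt_eqF.
  rewrite -powR_mulrn ?powR_ge0// -powRrM [alpha * _]mulrC.
  rewrite powRM ?sqr_ge0 ?divr_ge0 ?mulr_ge0 ?ltW//.
  rewrite powR_sqr ?(ltW E0)// powR_div ?mulr_ge0 ?(ltW t0) ?(ltW t1')//.
  by rewrite powRM ?(ltW t0) ?(ltW t1')// powRN.
rewrite /euler_weight -/z.
have -> : alpha + k%:R * alpha - 1 = (alpha - 1) + k%:R * alpha by ring.
have -> : - (alpha + k%:R * alpha) - (nu - 1) / 2 =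
  (- alpha - (nu - 1) / 2) + - (k%:R * alpha) by ring.
by rewrite !powRDp//; ring.
Qed.

Let integrable_weight k :
  mu.-integrable `]0, 1[ (fun t => (euler_weight (alpha + k%:R * alpha) t)%:E).
Proof. by have [] := bessel_kernel_euler nu_ge0 (order_gt0 k) xy. Qed.

Let bessel_kernelE k : bessel_kernel nu (alpha + k%:R * alpha) x y =
  E `^ (2 * alpha - 1) * (E `^ (2 * (k%:R * alpha)) / G2 k
   * \int[mu]_(t in `]0, 1[) euler_weight (alpha + k%:R * alpha) t).
Proof.
have [_ /= ->] := bessel_kernel_euler nu_ge0 (order_gt0 k) xy.
rewrite -/D -/E -/(G2 k).
have -> : 2 * (alpha + k%:R * alpha) - 1 = (2 * alpha - 1) + 2 * (k%:R * alpha) by ring.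
rewrite powRDp// !mulrA.
by [].
Qed.

Let mlE t k : mittag_leffler_term t k =
  lambda ^- k * ((G2 k)^-1)%:C * (euler_ratio t ^+ k)%:C.
Proof.
rewrite /mittag_leffler_term prodr_const card_ord -/(G2 k) exprMn exprVn.
have -> : ((G2 k)^-1)%:C = (G2 k)%:C^-1 by rewrite rmorphV ?unitfE ?gt_eqF.
have -> : (euler_ratio t ^+ k)%:C = (euler_ratio t)%:C ^+ k by rewrite rmorphXn.
exact: mulrAC.
Qed.

Let cabs_ml t k :
  cabs (mittag_leffler_term t k) = (euler_ratio t / cabs lambda) ^+ k / G2 k.
Proof.
rewrite mlE !cabsM cabsV cabsX !cabs_real ?exprn_ge0// ?invr_ge0 ?ltW//.
by rewrite expr_div_n mulrC mulrA.
Qed.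

Let csummable_ml t : csummable (mittag_leffler_term t).
Proof.
have := mittag_leffler_abs_summable alpha_gt0
  (divr_ge0 (ratio_ge0 t) (cabs_ge0 lambda)).
by rewrite /csummable; under eq_eseriesr do rewrite -cabs_ml.
Qed.

Let M : R := (4^-1 * (D ^+ 2 / x ^+ 2)) `^ alpha.

Let ratio_le t : 0 < t < 1 -> euler_ratio t <= M.
Proof.
move=> t01; case/andP: (t01) => t0 t1.
have t1' : 0 < 1 - t by rewrite subr_gt0.
have h : x ^+ 2 <= y ^+ 2 - D * t.
  rewrite lerBrDr -lerBrDl -/D.
  by rewrite -[leRHS]mulr1 ler_pM2l// ltW.
have h0 := lt_le_trans (exprn_gt0 2 x0) h.
have tt : 0 <= t * (1 - t) <= 1.
  by rewrite mulr_ge0 ?(ltW t0) ?(ltW t1')//= mulr_ile1 ?(ltW t0) ?(ltW t1) ?(ltW t1')// lerBlDr lerDl ltW.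
rewrite /euler_ratio /M -/D; apply: ge0_ler_powR; rewrite ?(ltW alpha_gt0)//.
- rewrite nnegrE mulr_ge0// divr_ge0 ?(ltW h0)// mulr_ge0 ?sqr_ge0//.
  by case/andP: tt.
- by rewrite nnegrE mulr_ge0// divr_ge0 ?sqr_ge0.
rewrite ler_wpM2l// ler_pM ?invr_ge0 ?(ltW h0)//.
- by rewrite mulr_ge0 ?sqr_ge0//; case/andP: tt.
- by rewrite ler_piMl ?sqr_ge0//; case/andP: tt.
- by rewrite lef_pV2// posrE exprn_gt0.
Qed.

Let G (k : nat) (t : R) : R[i] := (euler_weight alpha t)%:C * mittag_leffler_term t k.

Let GE k : {in `]0, 1[%classic, G k =1 (fun t =>
  (lambda ^- k * (E `^ (2 * (k%:R * alpha)) / G2 k)%:C)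
   * (euler_weight (alpha + k%:R * alpha) t)%:C)}.
Proof.
move=> t; rewrite inE/= in_itv/= => t01; rewrite /G mlE.
rewrite mulrCA -[lambda ^- k * _ * _]mulrA -!mulrA; congr (_ * _).
rewrite -!rmorphM/=; congr (_%:C).
by rewrite weight_ratio//; ring.
Qed.

Let cintegrable_weight k :
  cintegrable `]0, 1[ (fun t => (euler_weight (alpha + k%:R * alpha) t)%:C).
Proof.
split; first exact: integrable_weight.
by have H := @integrable0 _ (measurableTypeR R) R mu `]0, 1[%classic; apply: H.
Qed.

Let G_int k : cintegrable `]0, 1[ (G k) /\
  (E `^ (2 * alpha - 1))%:C * cintegral `]0, 1[ (G k) =
  lambda ^- k * (bessel_kernel nu (alpha + k%:R * alpha) x y)%:C.
Proof.
have [i1 i2] := cintegral_scale (lambda ^- k * (E `^ (2 * (k%:R * alpha)) / G2 k)%:C)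
   (measurable_itv `]0, 1[) (cintegrable_weight k).
split.
  by apply: eq_cintegrable i1; [exact: measurable_itv|move=> t t01; rewrite GE].
rewrite (eq_cintegral (@GE k)) i2 cintegral_real bessel_kernelE.
rewrite -!mulrA [LHS]mulrCA; congr (_ * _).
by rewrite -!rmorphM/= -!mulrA.
Qed.

Let I01 : set R := `]0, 1[%classic.

Let G_abs : (\sum_(k <oo) \int[mu]_(t in I01) (cabs (G k t))%:E < +oo)%E.
Proof.
set w := (\int[mu]_(t in I01) (euler_weight alpha t)%:E)%E.
have iw : mu.-integrable `]0, 1[ (fun t => (euler_weight alpha t)%:E).
  by have := integrable_weight 0; rewrite mul0r addr0.
have w0 : (0 <= w)%E by apply: integral_ge0 => t _; rewrite lee_fin.
have wf : w \is a fin_num.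
  by have H := integrable_fin_num _ iw; apply: H; exact: measurable_itv.
pose b k : R := (M / cabs lambda) ^+ k / G2 k.
have b0 k : 0 <= b k.
  apply: divr_ge0; last exact: ltW.
  by rewrite exprn_ge0// divr_ge0 ?powR_ge0 ?cabs_ge0.
apply: (@le_lt_trans _ _ (\sum_(k <oo) (w * (b k)%:E))%E); last first.
  rewrite -(fineK wf) nneseriesZl; last by move=> k _; rewrite lee_fin.
  rewrite lte_mul_pinfty ?fineK//.
  by apply: (mittag_leffler_abs_summable alpha_gt0); rewrite divr_ge0 ?powR_ge0 ?cabs_ge0.
apply: lee_nneseries => [k _ _|k _].
  by apply: integral_ge0 => t _; rewrite lee_fin cabs_ge0.
rewrite /w muleC -ge0_integralZl_EFin//; last 3 first.
- exact: measurable_itv.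
- by move=> t _; rewrite lee_fin.
- exact: measurable_int iw.
apply: ge0_le_integral => //.
- exact: measurable_itv.
- by move=> t _; rewrite lee_fin cabs_ge0.
- have [[/measurable_int/measurable_EFinP m1 /measurable_int/measurable_EFinP m2] _] := G_int k.
  exact: measurable_cabs.
- by apply: measurable_funeM; exact: measurable_int iw.
move=> t It; have t01 : 0 < t < 1 by move: It; rewrite /I01/= in_itv.
rewrite -EFinM lee_fin cabsM cabs_real// mulrC ler_wpM2r//.
rewrite cabs_ml ler_wpM2r ?invr_ge0 ?(ltW (G2_gt0 k))//.
rewrite lerXn2r ?nnegrE ?divr_ge0 ?powR_ge0 ?cabs_ge0//.
by rewrite ler_wpM2r ?invr_ge0 ?cabs_ge0// ratio_le.
Qed.

Let G_sum : (fun t => csum (G ^~ t)) =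
  (fun t => (euler_weight alpha t)%:C * csum (mittag_leffler_term t)).
Proof. by apply/funext => t; rewrite csumZ. Qed.

(** Term by term, the integral of the weight against the [k]-th power of the
    ratio is, by [weight_ratio], Euler's integral for the kernel of order
    [alpha + k alpha]. *)
Lemma inner_integral_series (h := fun t => (euler_weight alpha t)%:C * csum (mittag_leffler_term t)) :
  cintegrable `]0, 1[ h /\
  csum (fun k => lambda ^- k * (bessel_kernel nu (alpha + k%:R * alpha) x y)%:C) =
    (E `^ (2 * alpha - 1))%:C * cintegral `]0, 1[ h.
Proof.
have [i s] := cintegral_series_integrable (measurable_itv `]0, 1[)
  (fun k => proj1 (G_int k)) (fun t _ => csummableZ _ (csummable_ml t)) G_abs.
rewrite /h -G_sum; split=> //.
apply: csum_lim.
have H := cvgZl_tmp (k := (E `^ (2 * alpha - 1))%:C) s.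
apply: (cvg_trans _ (H _)); apply: near_eq_cvg; apply: nearW => n.
rewrite /series/= /GRing.scale/= mulr_sumr; apply: eq_bigr => k _.
exact: (proj2 (G_int k)).
Qed.

(** Up to a common factor, the moduli of the terms are the integrals of the
    moduli, whose sum has been bounded by means of the Mittag-Leffler series. *)
Lemma inner_integral_csummable :
  csummable (fun k => lambda ^- k * (bessel_kernel nu (alpha + k%:R * alpha) x y)%:C).
Proof.
apply: (@le_lt_trans _ _ (\sum_(k <oo) ((E `^ (2 * alpha - 1))%:E *
    \int[mu]_(t in I01) (cabs (G k t))%:E))%E); last first.
  rewrite nneseriesZl ?lte_mul_pinfty ?lee_fin ?powR_ge0//.
  by move=> k _; apply: integral_ge0 => t _; rewrite lee_fin cabs_ge0.
apply: lee_nneseries => [k _ _|k _]; first by rewrite lee_fin cabs_ge0.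
have -> : (\int[mu]_(t in I01) (cabs (G k t))%:E =
  ((cabs (lambda ^- k) * (E `^ (2 * (k%:R * alpha)) / G2 k))
   * \int[mu]_(t in `]0, 1[) euler_weight (alpha + k%:R * alpha) t)%:E)%E.
  have e0 : 0 <= E `^ (2 * (k%:R * alpha)) / G2 k by rewrite divr_ge0 ?powR_ge0 ?ltW.
  transitivity (\int[mu]_(t in I01) ((cabs (lambda ^- k) * (E `^ (2 * (k%:R * alpha)) / G2 k))%:E * (euler_weight (alpha + k%:R * alpha) t)%:E))%E.
    apply: eq_integral => t t01; rewrite GE//= !cabsM.
    by rewrite [cabs (_ / _)%:C]cabs_real// [cabs (euler_weight _ _)%:C]cabs_real.
  rewrite [RHS]EFinM /Rintegral fineK; last first.
    by have H := integrable_fin_num _ (integrable_weight k); apply: H; exact: measurable_itv.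
  rewrite ge0_integralZl_EFin//.
  - exact: measurable_itv.
  - by move=> t _; rewrite lee_fin.
  - exact: measurable_int (integrable_weight k).
  - by rewrite mulr_ge0 ?cabs_ge0.
rewrite -EFinM lee_fin cabsM bessel_kernelE cabs_real.
  by rewrite -!mulrA mulrCA.
rewrite !mulr_ge0 ?powR_ge0 ?invr_ge0 ?(ltW (G2_gt0 k))//.
by apply: Rintegral_ge0.
Qed.

End InnerIntegral.

(** * The Neumann series *)

(** A function of class [C^(n+1)] on the half-line is continuous there; it is cut
    off because nothing is known of its values elsewhere. *)
Lemma measurable_Cn_pos (R : realType) n (u : R -> R) : Cn_pos n.+1 u ->
  measurable_fun setT (fun y : R => if 0 < y then u y else 0).
Proof.
move=> [du _].
have mu0 : measurable_fun (`]0, +oo[%classic : set R) u.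
  apply: measurable_fun_open_cont; first exact: interval_open.
  move=> x; rewrite /= in_itv/= andbT => x0.
  exact/differentiable_continuous/derivable1_diffP/(du 0 x).
have /measurable_restrictT := mu0.
move=> /(_ (measurable_itv _)).
congr measurable_fun; apply/funext => y; rewrite patchE.
by rewrite mem_setE in_itv/= andbT.
Qed.

Section NeumannSeries.
Context {R : realType}.
Local Notation mu := (@lebesgue_measure R).
Variables (nu alpha : R) (lambda : R[i]) (f : R -> R[i]).
Hypotheses (nu_ge0 : 0 <= nu) (alpha_gt0 : 0 < alpha) (lambda_neq0 : lambda != 0).

Local Notation N := (fun k => iter k (bessel_int nu alpha) f).
Local Notation L := (cabs lambda).
Local Notation K k x y := (bessel_kernel nu (alpha + k%:R * alpha) x y).

Let on_pos (P : R[i] -> R) (y : R) : R := if 0 < y then P (f y) else 0.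

(** The [k]-th iterate applied to [|f|], cut off to the half-line so as to be
    measurable on the line. *)
Definition majorant (k : nat) : R -> \bar R :=
  if k is k'.+1 then kernel_int (iter_kernel nu alpha k') (EFin \o on_pos cabs)
  else EFin \o on_pos cabs.

Hypothesis f_Re : measurable_fun setT (on_pos (@complex.Re R)).
Hypothesis f_Im : measurable_fun setT (on_pos (@complex.Im R)).
Hypothesis f_summable : forall x : R, 0 < x ->
  (\sum_(1 <= k <oo) ((L ^- k)%:E
     * iter k (bessel_int_ge0 nu alpha) (fun y => (cabs (f y))%:E) x) < +oo)%E.

Let L_gt0 : 0 < L. Proof. exact: cabs_gt0. Qed.

Let w_ge0 y : 0 <= on_pos cabs y.
Proof. by rewrite /on_pos; case: ifP => // _; exact: cabs_ge0. Qed.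

Let measurable_w : measurable_fun setT (EFin \o on_pos cabs).
Proof.
have := @measurable_cabs R setT (fun y => on_pos (@complex.Re R) y +i* on_pos (@complex.Im R) y) f_Re f_Im.
congr measurable_fun; apply/funext => y /=; congr EFin; rewrite /on_pos.
by case: ifP => // _; [case: (f y)|rewrite /cabs/= expr0n/= addr0 sqrtr0].
Qed.

Lemma majorant_ge0 k y : (0 <= majorant k y)%E.
Proof.
case: k => [|k]; first by rewrite lee_fin.
by apply: kernel_int_ge0 => [|z]; [exact: ge0_iter_kernel|rewrite lee_fin].
Qed.

Lemma measurable_majorant k : measurable_fun setT (majorant k).
Proof.
by case: k => [//|k]; apply: measurable_kernel_int => //; exact: ge0_iter_kernel.
Qed.

Lemma majorantS k x : kernel_int (iter_kernel nu alpha 0) (majorant k) x = majorant k.+1 x.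
Proof.
case: k => [//|k]; rewrite /majorant -iter_kernelS//.
exact: (kernel_int_comp x (ge0_iter_kernel nu alpha 0) (ge0_iter_kernel nu alpha k)).
Qed.

Let iter_majorant k x : 0 < x ->
  iter k (bessel_int_ge0 nu alpha) (fun y => (cabs (f y))%:E) x = majorant k x.
Proof.
elim: k x => [|k ih] x x0; first by rewrite /= /on_pos x0.
rewrite iterS bessel_int_ge0E// -majorantS.
by apply: eq_kernel_int => // y y0; exact: ih.
Qed.

Lemma majorant_summable x : 0 < x ->
  (\sum_(k <oo) ((L ^- k.+1)%:E * majorant k.+1 x) < +oo)%E.
Proof.
move=> x0; have := f_summable x0.
rewrite -nneseries_addn; last first.
  move=> k; rewrite iter_majorant// mule_ge0 ?majorant_ge0// lee_fin.
  by rewrite invr_ge0 exprn_ge0 ?cabs_ge0.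
by under eq_eseriesr do rewrite addn1 iter_majorant//.
Qed.

Lemma majorant_lty k x : 0 < x -> (majorant k.+1 x < +oo)%E.
Proof.
move=> x0; have := majorant_summable x0.
have h j : (0 <= (L ^- j.+1)%:E * majorant j.+1 x)%E.
  by rewrite mule_ge0 ?majorant_ge0// lee_fin invr_ge0 exprn_ge0 ?cabs_ge0.
move=> /(le_lt_trans (nneseries_ge_term k h)).
have e0 : (0 < (L ^- k.+1)%:E)%E by rewrite lte_fin invr_gt0 exprn_gt0.
case: (majorant k.+1 x) (majorant_ge0 k.+1 x) => [r _ _|_|//].
  exact: ltry.
by rewrite gt0_muley.
Qed.

Section Part.
(* P is the real or the imaginary part *)
Variable P : R[i] -> R.
Hypothesis PZ : forall (a : R) (z : R[i]), P (a%:C * z) = a * P z.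
Hypothesis P_le : forall z, `|P z| <= cabs z.
Hypothesis Pint : forall D h, P (cintegral D h) = \int[mu]_(t in D) P (h t).
Hypothesis mP : measurable_fun setT (on_pos P).

Let P_le_w y : `|on_pos P y| <= on_pos cabs y.
Proof. by rewrite /on_pos; case: ifP => // _; rewrite normr0. Qed.

Let kernel_int_abs k x :
  (kernel_int (iter_kernel nu alpha k) (fun y => `|on_pos P y|%:E) x <= majorant k.+1 x)%E.
Proof.
have k0 z : (0 <= iter_kernel nu alpha k z)%E by case: (ge0_iter_kernel nu alpha k).
have mk : measurable_fun setT (fun y => iter_kernel nu alpha k (x, y)).
  by apply: ge0_kernel_left; exact: ge0_iter_kernel.
apply: ge0_le_integral => //.
- by move=> y _; rewrite mule_ge0 ?lee_fin.
- by apply: emeasurable_funM => //; apply/measurable_EFinP; exact: measurableT_comp.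
- exact: emeasurable_funM.
- by move=> y _; rewrite lee_wpmul2l ?lee_fin.
Qed.

Let kernel_int_fin k x : 0 < x ->
  (kernel_int (iter_kernel nu alpha k) (fun y => `|on_pos P y|%:E) x < +oo)%E.
Proof. by move=> x0; exact: (le_lt_trans (kernel_int_abs k x) (majorant_lty k x0)). Qed.

Let part_bessel_int h x :
  P (bessel_int nu alpha h x) = real_bessel_int nu alpha (P \o h) x.
Proof. by rewrite Pint; apply: eq_Rintegral => y _; rewrite PZ. Qed.

Let part_iter k x : 0 < x -> P (N k x) = iter k (real_bessel_int nu alpha) (on_pos P) x.
Proof.
elim: k x => [|k ih] x x0; first by rewrite /= /on_pos x0.
rewrite !iterS part_bessel_int; apply: eq_Rintegral => y.
rewrite inE/= in_itv/= andbT => xy; congr (_ * _).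
by apply: ih; exact: lt_trans xy.
Qed.

Lemma part_integrable k x : 0 < x ->
  mu.-integrable `]x, +oo[ (fun y => (P ((bessel_kernel nu alpha x y)%:C * N k y))%:E).
Proof.
move=> x0.
have := integrable_iter_kernel nu_ge0 alpha_gt0 x0
  (integrable_iter_real_bessel_int nu_ge0 alpha_gt0 mP kernel_int_fin k x0).
rewrite mul0r addr0; apply: eq_integrable; first exact: measurable_itv.
move=> y; rewrite inE/= in_itv/= andbT => xy.
by rewrite PZ EFinM -part_iter// (lt_trans x0).
Qed.

Lemma part_kernel_integrable k x : 0 < x ->
  mu.-integrable `]x, +oo[ (fun y => (P ((K k x y)%:C * f y))%:E).
Proof.
move=> x0; have := integrable_iter_kernel nu_ge0 alpha_gt0 x0
  (integrable_iter_kernelT mP kernel_int_fin k x0).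
apply: eq_integrable; first exact: measurable_itv.
move=> y; rewrite inE/= in_itv/= andbT => xy.
by rewrite PZ EFinM /= /on_pos (lt_trans x0 xy).
Qed.

Lemma part_kernel_integral k x : 0 < x ->
  \int[mu]_(y in `]x, +oo[) P ((K k x y)%:C * f y) = P (N k.+1 x).
Proof.
move=> x0; rewrite part_iter//.
have H := iter_real_bessel_int nu_ge0 alpha_gt0 mP kernel_int_fin k x0.
rewrite -[RHS]/(fine (iter k.+1 (real_bessel_int nu alpha) (on_pos P) x)%:E) H.
rewrite -(integral_iter_kernel nu_ge0 alpha_gt0 k _ x0).
congr fine; apply: eq_integral => y; rewrite inE/= in_itv/= andbT => xy.
by rewrite PZ EFinM /= /on_pos (lt_trans x0 xy).
Qed.

Lemma part_iter_le k x : 0 < x -> (`|P (N k x)|%:E <= majorant k x)%E.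
Proof.
case: k => [|k] x0; first by rewrite lee_fin /= /on_pos x0.
rewrite part_iter// -abse_EFin.
rewrite (iter_real_bessel_int nu_ge0 alpha_gt0 mP kernel_int_fin k x0).
apply: le_trans (kernel_int_abs k x).
have k0 z : (0 <= iter_kernel nu alpha k z)%E by case: (ge0_iter_kernel nu alpha k).
apply: le_trans (le_abse_integral _ _ _) _ => //.
  apply: emeasurable_funM; first by apply: ge0_kernel_left; exact: ge0_iter_kernel.
  exact/measurable_EFinP.
rewrite le_eqVlt; apply/orP; left; apply/eqP; apply: eq_integral => y _.
by rewrite (abseM (iter_kernel nu alpha k _)) (gee0_abs (k0 _)).
Qed.

End Part.

Let Re_int D h : complex.Re (cintegral D h) = \int[mu]_(t in D) complex.Re (h t).
Proof. by []. Qed.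

Let Im_int D h : complex.Im (cintegral D h) = \int[mu]_(t in D) complex.Im (h t).
Proof. by []. Qed.

Lemma bessel_integrable_iter k x : 0 < x -> bessel_integrable nu alpha (N k) x.
Proof.
move=> x0; split.
- exact: (part_integrable (@Re_realM R) (@Re_le_cabs R) Re_int f_Re k x0).
- exact: (part_integrable (@Im_realM R) (@Im_le_cabs R) Im_int f_Im k x0).
Qed.

Lemma iter_bessel_int k x : 0 < x ->
  cintegrable `]x, +oo[ (fun y => (K k x y)%:C * f y) /\
  cintegral `]x, +oo[ (fun y => (K k x y)%:C * f y) = N k.+1 x.
Proof.
move=> x0; split; first split.
- exact: (part_kernel_integrable (@Re_realM R) (@Re_le_cabs R) f_Re k x0).
- exact: (part_kernel_integrable (@Im_realM R) (@Im_le_cabs R) f_Im k x0).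
rewrite /cintegral.
rewrite (part_kernel_integral (@Re_realM R) (@Re_le_cabs R) Re_int f_Re k x0).
rewrite (part_kernel_integral (@Im_realM R) (@Im_le_cabs R) Im_int f_Im k x0).
by case: (N k.+1 x).
Qed.

(** The factor [2] pays for bounding the two components separately. *)
Lemma cabs_iter_le k x : 0 < x -> ((cabs (N k x))%:E <= 2%:E * majorant k x)%E.
Proof.
move=> x0; apply: (@le_trans _ _ (`|complex.Re (N k x)|%:E + `|complex.Im (N k x)|%:E)%E).
  by rewrite -EFinD lee_fin cabs_le.
rewrite mule_natl mule2n; apply: leeD.
- exact: (part_iter_le (@Re_realM R) (@Re_le_cabs R) Re_int f_Re k x0).
- exact: (part_iter_le (@Im_realM R) (@Im_le_cabs R) Im_int f_Im k x0).
Qed.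

Let summable2 x : 0 < x ->
  (\sum_(k <oo) (2%:E * ((L ^- k.+1)%:E * majorant k.+1 x)) < +oo)%E.
Proof.
move=> x0; rewrite nneseriesZl.
  by rewrite lte_mul_pinfty ?lee_fin//; exact: majorant_summable.
move=> k _; rewrite mule_ge0 ?majorant_ge0// lee_fin.
by rewrite invr_ge0 exprn_ge0 ?cabs_ge0.
Qed.

Lemma csummable_neumann x : 0 < x -> csummable (fun k => lambda ^- k * N k x).
Proof.
move=> x0; apply/csummableS; apply: le_lt_trans (summable2 x0).
apply: lee_nneseries => [k _ _|k _]; first by rewrite lee_fin cabs_ge0.
rewrite /= cabsM cabsV cabsX EFinM muleCA lee_pmul2l ?lte_fin ?invr_gt0 ?exprn_gt0//.
exact: (cabs_iter_le k.+1 x0).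
Qed.

Let bessel_kernel_ge0 k x y : 0 < x -> x < y -> 0 <= K k x y.
Proof.
move=> x0 xy; rewrite -lee_fin -(iter_kernelE nu_ge0 alpha_gt0) ?x0//.
by case: (ge0_iter_kernel nu alpha k).
Qed.

Let measurable_bessel_kernel k x : 0 < x ->
  measurable_fun (`]x, +oo[%classic : set R) (fun y => (K k x y)%:E).
Proof.
move=> x0; have : measurable_fun (`]x, +oo[%classic : set R) (fun y => iter_kernel nu alpha k (x, y)).
  by apply: measurable_funTS; apply: ge0_kernel_left; exact: ge0_iter_kernel.
apply: eq_measurable_fun => y; rewrite inE/= in_itv/= andbT => xy.
by rewrite iter_kernelE// x0.
Qed.

Let integral_majorant k j x : 0 < x ->
  (\int[mu]_(y in `]x, +oo[) ((K k x y)%:E * majorant j y) =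
   kernel_int (iter_kernel nu alpha k) (majorant j) x)%E.
Proof. by move=> x0; rewrite integral_iter_kernel. Qed.

Lemma csummable_neumann_term x : 0 < x ->
  csummable (neumann_term (bessel_int nu alpha) lambda f x).
Proof. by move=> x0; exact: (csummableS _).1 (csummable_neumann x0). Qed.

(** Common to the two termwise integrations below: one integrates the iterates
    [A^k f] against the kernel of [A], the other integrates [f] against the
    kernels of the iterates.  The terms have the same integrals in both cases;
    [i] and [j] say which majorant is integrated against which kernel. *)
Lemma neumann_exchange x (F : nat -> R -> R[i]) (i j : nat -> nat) : 0 < x ->
  (forall k, cintegrable `]x, +oo[ (F k) /\
     cintegral `]x, +oo[ (F k) = lambda ^- k * N k.+1 x) ->
  (forall y, x < y -> csummable (F ^~ y)) ->
  (forall k, kernel_int (iter_kernel nu alpha (i k)) (majorant (j k)) x = majorant k.+1 x) ->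
  (forall k y, x < y -> ((cabs (F k y))%:E <=
     (2 * L ^- k)%:E * ((K (i k) x y)%:E * majorant (j k) y))%E) ->
  cintegrable `]x, +oo[ (fun y => csum (F ^~ y)) /\
  cintegral `]x, +oo[ (fun y => csum (F ^~ y)) =
    lambda * csum (neumann_term (bessel_int nu alpha) lambda f x).
Proof.
move=> x0 iF sF ij Fle.
have absF : (\sum_(k <oo) \int[mu]_(y in [set` `]x, +oo[%R]) (cabs (F k y))%:E < +oo)%E.
  apply: (@le_lt_trans _ _
      (\sum_(k <oo) (L%:E * (2%:E * ((L ^- k.+1)%:E * majorant k.+1 x))))%E); last first.
    rewrite nneseriesZl.
      by rewrite lte_mul_pinfty ?lee_fin ?(ltW L_gt0)//; exact: summable2.
    move=> k _; rewrite !mule_ge0 ?majorant_ge0 ?lee_fin//.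
    by rewrite invr_ge0 exprn_ge0 ?cabs_ge0.
  apply: lee_nneseries => [k _ _|k _].
    by apply: integral_ge0 => y _; rewrite lee_fin cabs_ge0.
  have c0 : 0 <= 2 * L ^- k by rewrite mulr_ge0// invr_ge0 exprn_ge0 ?cabs_ge0.
  have mK : measurable_fun (`]x, +oo[%classic : set R)
      (fun y => (K (i k) x y)%:E * majorant (j k) y)%E.
    apply: emeasurable_funM; first exact: measurable_bessel_kernel.
    by apply: measurable_funTS; exact: measurable_majorant.
  apply: (@le_trans _ _ (\int[mu]_(y in [set` `]x, +oo[%R])
     ((2 * L ^- k)%:E * ((K (i k) x y)%:E * majorant (j k) y)))%E).
    apply: ge0_le_integral.
    - exact: measurable_itv.
    - by move=> y _; rewrite lee_fin cabs_ge0.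
    - have [[/measurable_int/measurable_EFinP m1 /measurable_int/measurable_EFinP m2] _] := iF k.
      exact: measurable_cabs.
    - exact: measurable_funeM.
    by move=> y; rewrite /= in_itv/= andbT; exact: Fle.
  rewrite ge0_integralZl_EFin//; last first.
    move=> y; rewrite /= in_itv/= andbT => xy.
    by rewrite mule_ge0 ?majorant_ge0// lee_fin bessel_kernel_ge0.
  rewrite integral_majorant// ij !muleA -!EFinM.
  rewrite (_ : L * 2 * L ^- k.+1 = 2 * L ^- k)//.
  by rewrite exprS invfM [L * 2]mulrC -mulrA mulVKf ?gt_eqF.
have [iS cS] := cintegral_series_integrable (measurable_itv `]x, +oo[)
  (fun k => (iF k).1)
  (fun y (h : [set` `]x, +oo[%R] y) => sF y (proj1 (andP (etrans (esym (in_itv _ _)) h)))) absF.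
split => //; rewrite -(csum_lim cS) -csumZ; last exact: csummable_neumann_term.
congr csum; apply/funext => k; rewrite (iF k).2 /neumann_term mulrA.
by rewrite exprS invfM mulrA mulfV// mul1r.
Qed.

(** Applying [A] to the term of index [k] gives [lambda] times that of index
    [k + 1]. *)
Lemma bessel_int_neumann x : 0 < x ->
  bessel_integrable nu alpha (fun y => csum (fun k => lambda ^- k * N k y)) x /\
  bessel_int nu alpha (fun y => csum (fun k => lambda ^- k * N k y)) x =
  lambda * csum (neumann_term (bessel_int nu alpha) lambda f x).
Proof.
move=> x0; rewrite /bessel_integrable /bessel_int.
pose F k y := lambda ^- k * ((bessel_kernel nu alpha x y)%:C * N k y).
have FE y : x < y -> csummable (F ^~ y) /\
    csum (F ^~ y) = (bessel_kernel nu alpha x y)%:C * csum (fun k => lambda ^- k * N k y).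
  move=> xy; have sy := csummable_neumann (lt_trans x0 xy).
  have -> : F ^~ y = (fun k => (bessel_kernel nu alpha x y)%:C * (lambda ^- k * N k y)).
    by apply/funext => k; rewrite /F mulrCA.
  by split; [exact: csummableZ|exact: csumZ].
have FE' : {in `]x, +oo[%classic, (fun y => csum (F ^~ y)) =1
    (fun y => (bessel_kernel nu alpha x y)%:C * csum (fun k => lambda ^- k * N k y))}.
  by move=> y; rewrite inE/= in_itv/= andbT => /FE[].
have [|y /FE[]//|||iS cS] := @neumann_exchange x F (fun=> 0%N) id x0.
- by move=> k; apply: cintegral_scale; [exact: measurable_itv|exact: bessel_integrable_iter].
- by move=> k; exact: majorantS.
- move=> k y xy; have := bessel_kernel_ge0 0 x0 xy; rewrite mul0r addr0 => K0.
  rewrite /F !cabsM cabsV cabsX (cabs_real K0).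
  rewrite [2 * _]mulrC [in leRHS]EFinM EFinM -muleA lee_wpmul2l ?lee_fin//.
    by rewrite invr_ge0 exprn_ge0 ?cabs_ge0.
  rewrite EFinM muleCA lee_wpmul2l ?lee_fin//.
  exact: (cabs_iter_le k (lt_trans x0 xy)).
split; first by apply: eq_cintegrable iS => //; exact: measurable_itv.
by rewrite -cS; apply: eq_cintegral => y /FE' ->.
Qed.

Lemma neumann_resolventE y : 0 < y ->
  neumann_resolvent (bessel_int nu alpha) lambda f y =
  - lambda^-1 * csum (fun k => lambda ^- k * N k y).
Proof.
move=> y0; rewrite csumS; last exact: csummable_neumann.
by rewrite /neumann_resolvent expr0 invr1 mul1r mulrDr !mulNr.
Qed.

(** [A] shifts the Neumann series: [A g] is [lambda g] without its first term,
    which is [- f]. *)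
Lemma resolvent_equation x (g := neumann_resolvent (bessel_int nu alpha) lambda f) :
  0 < x -> bessel_integrable nu alpha g x /\
  bessel_int nu alpha g x - lambda * g x = f x.
Proof.
move=> x0; have [i e] := bessel_int_neumann x0.
have [iZ eZ] := cintegral_scale (- lambda^-1) (measurable_itv `]x, +oo[) i.
have gE : {in `]x, +oo[%classic, (fun y => - lambda^-1 * ((bessel_kernel nu alpha x y)%:C *
     csum (fun k => lambda ^- k * N k y))) =1
   (fun y => (bessel_kernel nu alpha x y)%:C * g y)}.
  move=> y; rewrite inE/= in_itv/= andbT => xy.
  by rewrite /g neumann_resolventE ?(lt_trans x0)// mulrCA.
split; first by apply: eq_cintegrable iZ => //; exact: measurable_itv.
rewrite /bessel_int -(eq_cintegral gE) eZ -/(bessel_int _ _ _ _) e.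
rewrite /g /neumann_resolvent !mulNr mulrA mulVf// mul1r.
by rewrite mulrDr !mulrN !mulrA mulfV// !mul1r opprD !opprK addrCA addNr addr0.
Qed.

(** The bracket in the formula is the sum over [k] of the kernels of the iterates
    (see [inner_integral_series]); integrated against [f], it gives the Neumann
    series. *)
Lemma mittag_leffler_integral x (outer : R -> R[i]) : 0 < x ->
  (forall y, x < y -> outer y = f y *
    csum (fun k => lambda ^- k * (K k x y)%:C)) ->
  cintegrable `]x, +oo[ outer /\
  cintegral `]x, +oo[ outer =
    lambda * csum (neumann_term (bessel_int nu alpha) lambda f x).
Proof.
move=> x0 oE.
pose F k y := lambda ^- k * ((K k x y)%:C * f y).
have FE y : x < y -> csummable (F ^~ y) /\ csum (F ^~ y) = outer y.
  move=> xy; have sy : csummable (fun k => lambda ^- k * (K k x y)%:C).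
    by apply: inner_integral_csummable; rewrite ?x0.
  have -> : F ^~ y = (fun k => f y * (lambda ^- k * (K k x y)%:C)).
    by apply/funext => k; rewrite /F mulrA mulrC.
  by rewrite oE//; split; [exact: csummableZ|exact: csumZ].
have FE' : {in `]x, +oo[%classic, (fun y => csum (F ^~ y)) =1 outer}.
  by move=> y; rewrite inE/= in_itv/= andbT => /FE[].
have [|y /FE[]//|||iS cS] := @neumann_exchange x F id (fun=> 0%N) x0.
- move=> k; have [i <-] := iter_bessel_int k x0.
  by apply: cintegral_scale => //; exact: measurable_itv.
- by [].
- move=> k y xy; have K0 := bessel_kernel_ge0 k x0 xy.
  rewrite /F !cabsM cabsV cabsX (cabs_real K0).
  rewrite /= /on_pos (lt_trans x0 xy) -!EFinM lee_fin.
  rewrite -[2 * _ * _]mulrA ler_peMl ?ler1n//.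
  by rewrite mulr_ge0 ?invr_ge0 ?exprn_ge0 ?cabs_ge0// mulr_ge0 ?cabs_ge0.
split; first by apply: eq_cintegrable iS => //; exact: measurable_itv.
by rewrite -cS; apply: eq_cintegral => y /FE' ->.
Qed.

End NeumannSeries.

(** * The resolvent formula *)

Theorem theorem7p1 (R : realType) (nu alpha : R) (lambda : R[i])
    (f : R -> R[i])
    (nu_ge0 : 0 <= nu) (alpha_gt0 : 0 < alpha) (lambda_neq0 : lambda != 0)
    (f_smooth : cCn_pos (Num.truncn (2 * alpha)).+1 f)
    (f_summable : forall x : R, 0 < x ->
      (\sum_(1 <= k <oo) ((cabs lambda ^- k)%:E
         * iter k (bessel_int_ge0 nu alpha) (fun y => (cabs (f y))%:E) x)
       < +oo)%E) :
  let A := bessel_int nu alpha in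
  let g := neumann_resolvent A lambda f in
  let inner (x y t : R) : R[i] :=
    (t `^ (alpha - 1) * (1 - t) `^ (alpha - 1)
     * (1 - (1 - x ^+ 2 / y ^+ 2) * t) `^ (- alpha - (nu - 1) / 2))%:C
    * multi_mittag_leffler (fun _ : 'I_2 => alpha) (fun _ : 'I_2 => alpha)
        (lambda^-1
         * ((4^-1 * (t * (1 - t) * (y ^+ 2 - x ^+ 2) ^+ 2
                     / (y ^+ 2 - (y ^+ 2 - x ^+ 2) * t))) `^ alpha)%:C) in
  let outer (x y : R) : R[i] :=
    f y * (((y ^+ 2 - x ^+ 2) / (2 * y)) `^ (2 * alpha - 1))%:C
    * cintegral `]0, 1[ (inner x y) in
  forall x : R, 0 < x ->
    [/\ (* the iterates and the Neumann series are well defined *)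
        (forall k : nat, bessel_integrable nu alpha (iter k A f) x)
          /\ ccvg_series (neumann_term A lambda f x),
        (* (A - lambda I) g = f *)
        bessel_integrable nu alpha g x /\ A g x - lambda * g x = f x,
        (* the integrals in the formula are absolutely convergent *)
        (forall y : R, x < y -> cintegrable `]0, 1[ (inner x y))
          /\ cintegrable `]x, +oo[ (outer x)
      & g x = - lambda^-1 * f x
              - (lambda ^+ 2)^-1 * cintegral `]x, +oo[ (outer x)].
Proof.
move=> A g inner outer x x0.
have mRe := measurable_Cn_pos f_smooth.1.
have mIm := measurable_Cn_pos f_smooth.2.
have inner_outer y : x < y -> cintegrable `]0, 1[ (inner x y) /\ outer x y = f y *
    csum (fun k => lambda ^- k * (bessel_kernel nu (alpha + k%:R * alpha) x y)%:C).
  move=> xy; have xy0 : 0 < x < y by rewrite x0.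
  have [i e] := inner_integral_series lambda nu_ge0 alpha_gt0 xy0.
  by split => //; rewrite e /outer mulrA.
have [iO eO] := mittag_leffler_integral nu_ge0 alpha_gt0 lambda_neq0 mRe mIm
  f_summable x0 (fun y xy => (inner_outer y xy).2).
split.
- split=> [k|]; first exact: (bessel_integrable_iter nu_ge0 alpha_gt0 lambda_neq0 mRe mIm f_summable).
  apply/cvg_ex; eexists; apply: csum_cvg.
  exact: (csummable_neumann_term nu_ge0 alpha_gt0 lambda_neq0 mRe mIm f_summable).
- exact: (resolvent_equation nu_ge0 alpha_gt0 lambda_neq0 mRe mIm f_summable).
- by split=> // y /inner_outer[].
- rewrite eO /g /neumann_resolvent; congr (_ - _).
  by rewrite expr2 invfM -!mulrA mulKf.
Qed.
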